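(* Let $\mathcal{T}=(T_t)_{t\in\mathbb{R}}$ be a measurable, measure-preserving flow on a probability standard Borel space $(X,\mathcal{B},\mu)$ which is free, ergodic and has Ratner's property. Then its essential centralizer $EC(\mathcal{T}):=C(\mathcal{T})/\{T_t:\ t\in\mathbb{R}\}$ is discrete and countable.
   Context: ${\rm Aut}(X,\mathcal{B},\mu)$ is the group of measure-preserving automorphisms, viewed as unitary operators $Sf=f\circ S$ on $L^2(X,\mathcal{B},\mu)$ and equipped with the strong operator topology (a Polish group). A flow is measurable if $(x,t)\mapsto T_tx$ is measurable. The centralizer is $C(\mathcal{T})=\{S\in{\rm Aut}(X,\mathcal{B},\mu): ST_t=T_tS \text{ for all } t\}$, with the induced topology; $EC(\mathcal{T})$ carries the quotient topology. $R(t_0,P)$-property: let $(X,d)$ be a $\sigma$-compact metric space, $\mu$ a Borel probability measure and $(T_t)$ an ergodic flow. Fix a finite set $P\subset\mathbb{R}$ with $0\notin P$ and $t_0\in\mathbb{R}\setminus\{0\}$. $(T_t)$ has the $R(t_0,P)$-property if for every $\varepsilon>0$ and $N\in\mathbb{N}$ there exist $\kappa=\kappa(\varepsilon)>0$, $\delta=\delta(\varepsilon,N)>0$ and a set $Z=Z(\varepsilon,N)\subset X$ with $\mu(Z)>1-\varepsilon$ such that for all $x,y\in Z$ with $x$ not in the $(T_t)$-orbit of $y$ and $d(x,y)<\delta$ there exist $M,L\geq N$ with $L/M\geq\kappa$ and $p\in P$ such that $\frac1L\left|\{n\in[M,M+L]\cap\mathbb{Z}: d(T_{nt_0}x,T_{nt_0+p}y)<\varepsilon\}\right|>1-\varepsilon$.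 The flow has Ratner's property (with set $P$) if the set of $s\in\mathbb{R}$ for which it has the $R(s,P)$-property is uncountable. A flow on an abstract probability standard Borel space has Ratner's property if it is measure-theoretically isomorphic to a flow on a $\sigma$-compact metric space with Ratner's property (this does not depend on the choice of such a metric model). *)

(* Defs.v *)
From mathcomp Require Import all_boot all_algebra.
From mathcomp Require Import all_classical all_reals all_analysis.
From Stdlib Require List.
Set Implicit Arguments. Unset Strict Implicit. Unset Printing Implicit Defensive.
Import GRing.Theory Num.Theory.
Local Open Scope classical_set_scope.
Local Open Scope ring_scope.

Section Defs.
Context {R : realType}.

Section Metric.
Context {Y : Type} (dist : Y -> Y -> R).

Definition is_metric : Prop :=
  [/\ (forall x y, 0 <= dist x y),
      (forall x y, dist x y = 0 <-> x = y),
      (forall x y, dist x y = dist y x) &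
      (forall x y z, dist x z <= dist x y + dist y z)].

Definition dopen (A : set Y) : Prop :=
  forall x, A x -> exists2 r : R, 0 < r & forall y, dist x y < r -> A y.

Definition dborel : set (set Y) := <<s [set A | dopen A] >>.

Definition dcomplete : Prop :=
  forall u : nat -> Y,
    (forall e : R, 0 < e -> exists N, forall m n, (N <= m)%N -> (N <= n)%N ->
        dist (u m) (u n) < e) ->
    exists l, forall e : R, 0 < e -> exists N, forall n, (N <= n)%N ->
        dist (u n) l < e.

Definition dseparable : Prop :=
  exists u : nat -> Y, forall x (e : R), 0 < e -> exists n, dist x (u n) < e.

Definition dcompact (K : set Y) : Prop :=
  forall F : set (set Y), (forall A, F A -> dopen A) ->
    (forall x, K x -> exists2 A, F A & A x) ->
    exists s : seq (set Y), (forall A, List.In A s -> F A) /\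
      (forall x, K x -> exists2 A, List.In A s & A x).

Definition dsigma_compact : Prop :=
  exists K : nat -> set Y, (forall n, dcompact (K n)) /\ (forall x, exists n, K n x).

End Metric.

Section Meas.
Context {d : measure_display} {X : measurableType d}.

Definition standard_borel : Prop :=
  exists dist : X -> X -> R, [/\ is_metric dist, dcomplete dist, dseparable dist &
    (@measurable d X = dborel dist)].

Definition measure_preserving (mu : probability X R) (S : X -> X) : Prop :=
  measurable_fun setT S /\ forall A, measurable A -> mu (S @^-1` A) = mu A.

Definition mp_flow (mu : probability X R) (T : R -> X -> X) : Prop :=
  [/\ (forall x, T 0 x = x),
      (forall s t x, T (s + t) x = T s (T t x)),
      (forall t, measure_preserving mu (T t)) &
      measurable_fun setT (fun p : X * R => T p.2 p.1)].

Definition flow_ergodic (mu : probability X R) (T : R -> X -> X) : Prop :=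
  forall A, measurable A -> (forall t, T t @^-1` A = A) ->
    mu A = 0%E \/ mu A = 1%E.

Definition flow_free (mu : probability X R) (T : R -> X -> X) : Prop :=
  {ae mu, forall x, forall t, t != 0 -> T t x <> x}.

Definition is_aut (mu : probability X R) (S : X -> X) : Prop :=
  measure_preserving mu S /\
  exists S' : X -> X, [/\ measure_preserving mu S',
     {ae mu, forall x, S' (S x) = x} & {ae mu, forall x, S (S' x) = x}].

Definition centralizer (mu : probability X R) (T : R -> X -> X) : set (X -> X) :=
  [set S | is_aut mu S /\ forall t, {ae mu, forall x, S (T t x) = T t (S x)}].

(* S1, S2 define the same element of EC(T) = C(T)/{T_t}:
   S1 = S2 o T_t in Aut for some t *)
Definition ess_equiv (mu : probability X R) (T : R -> X -> X) (S1 S2 : X -> X) : Prop :=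
  exists t : R, {ae mu, forall x, S1 x = S2 (T t x)}.

Definition ec_class (mu : probability X R) (T : R -> X -> X) (S : X -> X) : set (X -> X) :=
  [set S' | centralizer mu T S' /\ ess_equiv mu T S' S].

Definition L2fun (mu : probability X R) (f : X -> R) : Prop :=
  measurable_fun setT f /\ (\int[mu]_x ((f x) ^+ 2)%:E < +oo)%E.

(* basic strong-operator-topology neighbourhood of the unitary U_S : f |-> f o S,
   restricted to operators U_{S'} with S' in Aut:
   ||U_{S'} f - U_S f||_2^2 < eps for f in the finite family fs *)
Definition sot_nbhd (mu : probability X R) (S : X -> X) (fs : seq (X -> R)) (eps : R)
  : set (X -> X) :=
  [set S' | forall f, List.In f fs ->
     (\int[mu]_x (((f (S' x) - f (S x)) ^+ 2)%:E) < eps%:E)%E].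

(* EC(T) with the quotient topology is discrete: each fiber of C(T) -> EC(T)
   is open in C(T) (with the topology induced from Aut, i.e. the SOT) *)
Definition EC_discrete (mu : probability X R) (T : R -> X -> X) : Prop :=
  forall S, centralizer mu T S ->
    exists fs : seq (X -> R), exists2 eps : R, 0 < eps &
      (forall f, List.In f fs -> L2fun mu f) /\
      (forall S', centralizer mu T S' -> sot_nbhd mu S fs eps S' ->
         ec_class mu T S S').

Definition EC_countable (mu : probability X R) (T : R -> X -> X) : Prop :=
  countable [set ec_class mu T S | S in centralizer mu T].

End Meas.

Definition flow_isomorphic {d1 d2 : measure_display}
  {X : measurableType d1} {Y : measurableType d2}
  (mu : probability X R) (T : R -> X -> X) (nu : probability Y R) (S : R -> Y -> Y)
  : Prop :=
  exists (phi : X -> Y) (psi : Y -> X),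
    [/\ measurable_fun setT phi, measurable_fun setT psi,
        (forall B, measurable B -> mu (phi @^-1` B) = nu B) &
        (forall A, measurable A -> nu (psi @^-1` A) = mu A)] /\
    [/\ {ae mu, forall x, psi (phi x) = x},
        {ae nu, forall y, phi (psi y) = y} &
        (forall t, {ae mu, forall x, phi (T t x) = S t (phi x)})].

Definition R_property {d : measure_display} {Y : measurableType d}
  (dist : Y -> Y -> R) (nu : probability Y R) (S : R -> Y -> Y)
  (t0 : R) (P : seq R) : Prop :=
  forall eps : R, 0 < eps ->
  exists2 kappa : R, 0 < kappa &
  forall N : nat,
  exists2 delta : R, 0 < delta &
  exists Z : set Y, [/\ measurable Z, ((1 - eps)%:E < nu Z)%E &
    forall x y, Z x -> Z y -> ~ (exists t, x = S t y) -> dist x y < delta ->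
      exists M L : nat, [/\ (N <= M)%N, (N <= L)%N, kappa <= L%:R / M%:R &
        exists2 p, p \in P &
          1 - eps < (count (fun n : nat =>
                        dist (S (n%:R * t0) x) (S (n%:R * t0 + p) y) < eps)
                      (iota M L.+1))%:R / L%:R]].

Definition metric_ratner {d : measure_display} {Y : measurableType d}
  (dist : Y -> Y -> R) (nu : probability Y R) (S : R -> Y -> Y) : Prop :=
  exists P : seq R, 0 \notin P /\
    ~ countable [set s : R | s != 0 /\ R_property dist nu S s P].

Definition has_ratner_property {d : measure_display} {X : measurableType d}
  (mu : probability X R) (T : R -> X -> X) : Prop :=
  exists (dY : measure_display) (Y : measurableType dY)
         (dist : Y -> Y -> R) (nu : probability Y R) (S : R -> Y -> Y),
    [/\ is_metric dist, dsigma_compact dist &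
        @measurable dY Y = dborel dist] /\
    [/\ mp_flow nu S, flow_ergodic nu S,
        flow_isomorphic mu T nu S &
        metric_ratner dist nu S].

End Defs.

(* Main.v *)
(* If an automorphism V commutes with the flow and is close to the identity, then for
   most y the points y and V y are delta-close.  Were they on different orbits, Ratner's
   property would give p in P and a long window of times n at which T_{n t0} y is close
   to T_{n t0 + p} (V y) = V (T_p (T_{n t0} y)).  By the maximal inequality V moves most
   points of that window very little, so T_p z would be close to z for most
   z = T_{n t0} y, which freeness and the pointwise ergodic theorem exclude.  Hence V y
   lies on the orbit of y on a set of positive measure, and ergodicity forces V = T_t for
   a single t.  Ergodicity of T_{t0} is not used: the window averages of the indicator of
   {d (T_p z, z) small} converge, and the maximal inequality bounds their limit.
   Consequently automorphisms in different classes are uniformly separated in measure,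
   which gives discreteness, and countability since the measure algebra is separable. *)
Require Import Defs.
From mathcomp Require Import all_boot all_order all_algebra.
From mathcomp Require Import all_classical all_reals all_analysis.
From mathcomp Require Import measurable_realfun ring lra.
From Stdlib Require List.
Set Implicit Arguments. Unset Strict Implicit. Unset Printing Implicit Defensive.
Import Order.TTheory GRing.Theory Num.Theory.
Import numFieldNormedType.Exports.
Local Open Scope classical_set_scope.
Local Open Scope ring_scope.

(** * Measurable sets and real-valued probabilities *)

(** The order of choices shapes the main estimate. Ratner's property fixes [kappa] before [N], and
    only then [delta]; so [N] may come from the ergodic theorem applied to the set of near-returns,
    which does not involve V. The set of points that V moves noticeably does involve V, so a
    convergence threshold for it would depend on V; the maximal inequality instead bounds all its
    averages at once, from its measure alone. Thus [delta] and [eta] serve every V. The bound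
    [kappa <= L / M] lets two initial sums control the window between them: an error proportional to
    M is also one proportional to L.

    Passing from a positive-measure set of y with V y on the orbit of y to a single time has its own
    obstacle: [V y = S t y] carries an uncountable quantifier over t. Occupation times of basic
    balls give countably many real coordinates that separate points and are Lipschitz in t, so the
    set of y admitting a t in a given compact interval is measurable; the zero-one law then squeezes
    the interval to a point. *)

Section MeasurableSets.
Context d (T : measurableType d).

Lemma measurable_preimT d' (U : measurableType d') (f : T -> U) (B : set U) :
  measurable_fun setT f -> measurable B -> measurable (f @^-1` B).
Proof. by move=> mf mB; rewrite -[X in measurable X]setTI; exact: mf. Qed.

Lemma measurable_bool (b : T -> bool) :
  measurable_fun setT b -> measurable [set x | b x].
Proof.
move=> mb; have -> : [set x | b x] = b @^-1` [set true] by [].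
exact: measurable_preimT.
Qed.

Lemma measurable_exists (I : countType) (Q : I -> T -> Prop) :
  (forall i, measurable [set x | Q i x]) ->
  measurable [set x | exists i, Q i x].
Proof.
move=> mQ.
have -> : [set x | exists i, Q i x] =
    \bigcup_n (if unpickle n is Some i then [set x | Q i x] else set0).
  apply/seteqP; split=> x /=.
    by move=> [i Qi]; exists (pickle i) => //; rewrite pickleK.
  by move=> [n _]; case: (unpickle n) => // i Qi; exists i.
by apply: bigcupT_measurable => n; case: (unpickle n).
Qed.

Lemma measurable_forall (I : countType) (Q : I -> T -> Prop) :
  (forall i, measurable [set x | Q i x]) ->
  measurable [set x | forall i, Q i x].
Proof.
move=> mQ; rewrite -[X in measurable X]setCK; apply: measurableC.
have -> : ~` [set x | forall i, Q i x] = [set x | exists i, ~ Q i x].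
  by apply/seteqP; split=> x /=; [move/existsNP | move=> h; apply/existsNP].
by apply: measurable_exists => i; exact: (measurableC (mQ i)).
Qed.

Lemma measurable_conj (Q1 Q2 : T -> Prop) :
  measurable [set x | Q1 x] -> measurable [set x | Q2 x] ->
  measurable [set x | Q1 x /\ Q2 x].
Proof. exact: measurableI. Qed.

Lemma measurable_impl (A : Prop) (Q : T -> Prop) :
  measurable [set x | Q x] -> measurable [set x | A -> Q x].
Proof.
move=> mQ; have [a|na] := pselect A.
  by rewrite (_ : [set _ | _] = [set x | Q x])//; apply/seteqP; split=> x /=; tauto.
by rewrite (_ : [set _ | _] = setT)//; apply/seteqP; split=> x /=; tauto.
Qed.

Lemma measurable_conjl (A : Prop) (Q : T -> Prop) :
  measurable [set x | Q x] -> measurable [set x | A /\ Q x].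
Proof.
move=> mQ; have [a|na] := pselect A.
  by rewrite (_ : [set _ | _] = [set x | Q x])//; apply/seteqP; split=> x /=; tauto.
by rewrite (_ : [set _ | _] = set0)//; apply/seteqP; split=> x /=; tauto.
Qed.

Context (R : realType).

Lemma measurable_lt_fun (f g : T -> R) : measurable_fun setT f ->
  measurable_fun setT g -> measurable [set x | f x < g x].
Proof. by move=> mf mg; apply: measurable_bool; exact: measurable_fun_ltr. Qed.

Lemma measurable_le_fun (f g : T -> R) : measurable_fun setT f ->
  measurable_fun setT g -> measurable [set x | f x <= g x].
Proof. by move=> mf mg; apply: measurable_bool; exact: measurable_fun_ler. Qed.

End MeasurableSets.

Section RealProbability.
Context d (T : measurableType d) (R : realType) (P : probability T R).

Definition pr (A : set T) : R := fine (P A).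

Lemma prE A : measurable A -> P A = (pr A)%:E.
Proof. by move=> mA; rewrite /pr fineK// fin_num_measure. Qed.

Lemma pr_ge0 A : 0 <= pr A.
Proof. exact: fine_ge0. Qed.

Lemma le_pr A B : measurable A -> measurable B -> A `<=` B -> pr A <= pr B.
Proof.
move=> mA mB AB; rewrite -lee_fin -!prE//.
by apply: le_measure; rewrite ?inE.
Qed.

Lemma prT : pr setT = 1.
Proof. by rewrite /pr probability_setT. Qed.

Lemma prC A : measurable A -> pr (~` A) = 1 - pr A.
Proof.
move=> mA; rewrite {1}/pr probability_setC// prE//.
Qed.

Lemma pr_le1 A : measurable A -> pr A <= 1.
Proof. by move=> mA; rewrite -prT; exact: le_pr. Qed.

Lemma prU A B : measurable A -> measurable B -> pr (A `|` B) <= pr A + pr B.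
Proof.
move=> mA mB; rewrite -lee_fin EFinD -!prE//; last exact: measurableU.
exact: measureU2.
Qed.

Lemma prUU (A B C : set T) : measurable A -> measurable B -> measurable C ->
  A `<=` B `|` C -> pr A <= pr B + pr C.
Proof.
move=> mA mB mC ABC; apply: le_trans (prU mB mC).
by apply: le_pr => //; exact: measurableU.
Qed.

Lemma pr_bigU (I : Type) (s : seq I) (A : set T) (B : I -> set T) (c : R) :
  measurable A -> (forall i, measurable (B i)) -> (forall i, pr (B i) <= c) ->
  (forall x, A x -> exists2 i, List.In i s & B i x) -> pr A <= c *+ size s.
Proof.
elim: s A => [|i s IH] A mA mB Bc AB.
  rewrite (_ : A = set0) ?/pr ?measure0//.
  by apply/seteqP; split=> x // /AB[].
rewrite mulrS; apply: le_trans (_ : pr (B i) + pr (A `\` B i) <= _).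
  apply: prUU => //; first exact: measurableD.
  by move=> x Ax; have [Bx|nBx] := pselect (B i x); [left|right].
apply: lerD => //; apply: IH => //; first exact: measurableD.
by move=> x [/AB[j /= [<-|js] Bj] nB]//; exists j.
Qed.

Lemma ae_pr0 (A : set T) : measurable A -> pr A = 0 -> {ae P, forall x, ~ A x}.
Proof.
move=> mA A0; exists A; split=> //; first by rewrite prE// A0.
by move=> x /=; rewrite notK.
Qed.

Lemma pr0_ae (A : set T) : measurable A -> {ae P, forall x, ~ A x} -> pr A = 0.
Proof.
move=> mA [B [mB B0 AB]]; apply/eqP; rewrite eq_le pr_ge0 andbT.
rewrite -(_ : pr B = 0); last by rewrite /pr B0.
by apply: le_pr => // x Ax; apply: AB => /=; apply.
Qed.

Lemma le_pr_ae (A B : set T) : measurable A -> measurable B ->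
  {ae P, forall x, A x -> B x} -> pr A <= pr B.
Proof.
move=> mA mB AB.
have D0 : pr (A `\` B) = 0.
  apply: pr0_ae; first exact: measurableD.
  by apply: filterS AB => x AB [Ax]; apply; exact: AB.
rewrite -[leRHS]addr0 -D0; apply: prUU => //; first exact: measurableD.
by move=> x Ax; have [Bx|nBx] := pselect (B x); [left|right].
Qed.

Lemma eq_pr_ae (A B : set T) : measurable A -> measurable B ->
  {ae P, forall x, A x <-> B x} -> pr A = pr B.
Proof.
move=> mA mB AB; apply/eqP; rewrite eq_le !le_pr_ae//.
  by apply: filterS AB => x [].
by apply: filterS AB => x [].
Qed.

Lemma pr1_ae (A : set T) : measurable A -> pr A = 1 -> {ae P, forall x, A x}.
Proof.
move=> mA A1; have : pr (~` A) = 0 by rewrite prC// A1 subrr.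
by move/(ae_pr0 (measurableC mA)); apply: filterS => x /contrapT.
Qed.

(** Continuity from above. It supplies, directly or through [pr_cup1], the thresholds that hold off
    a set of small measure. *)
Lemma pr_cap0 (F : nat -> set T) (e : R) : (forall n, measurable (F n)) ->
  (forall n, F n.+1 `<=` F n) -> {ae P, forall x, exists n, ~ F n x} ->
  0 < e -> exists n, pr (F n) < e.
Proof.
move=> mF dF F0 e0.
have mcap : measurable (\bigcap_n F n) by exact: bigcapT_measurable.
have cap0 : P (\bigcap_n F n) = 0%E.
  rewrite prE// pr0_ae//; apply: filterS F0 => x [n nF] /(_ n I).
  exact: nF.
have /fine_cvg : P \o F @ \oo --> 0%E.
  rewrite -cap0; apply: nonincreasing_cvg_mu => //.
    by apply: le_lt_trans (probability_le1 _ _) _ => //; rewrite ltry.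
  by apply/nonincreasing_seqP => n; apply/subsetPset; exact: dF.
move=> /cvgrPdist_lt /(_ e e0)[N _ /(_ N (leqnn N))] /=.
rewrite sub0r normrN => h; exists N; apply: le_lt_trans h; exact: ler_norm.
Qed.

Lemma pr_cup1 (F : nat -> set T) (A : set T) (e : R) :
  measurable A -> (forall n, measurable (F n)) ->
  (forall n, F n `<=` F n.+1) -> {ae P, forall x, A x -> exists n, F n x} ->
  0 < e -> exists n, pr A < pr (F n) + e.
Proof.
move=> mA mF iF F1 e0.
have [|||n nP] := @pr_cap0 (fun n => A `\` F n) e _ _ _ e0.
- by move=> n; exact: measurableD.
- by move=> n x [Ax nF]; split=> // /iF.
- apply: filterS F1 => x h; have [/h[n Fn]|nA] := pselect (A x); last by exists 0%N => -[].
  by exists n => -[].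
exists n; apply: le_lt_trans (_ : pr (F n) + pr (A `\` F n) < _); last by rewrite ltrD2l.
apply: prUU => //; first exact: measurableD.
by move=> x Ax; have [Bx|nBx] := pselect (F n x); [left|right].
Qed.

End RealProbability.

(** * Pointwise ergodic theorem *)

Section BoundedMeasurable.
Context d (T : measurableType d) (R : realType) (P : probability T R).
Implicit Types f g : T -> R.

Definition bmf f := measurable_fun setT f /\ exists C, forall x, `|f x| <= C.

Lemma bmf_integrable f : bmf f -> P.-integrable setT (EFin \o f).
Proof.
move=> [mf [C fC]]; apply: measurable_bounded_integrable => //.
  by apply: le_lt_trans (probability_le1 _ _) _ => //; rewrite ltry.
exists C; split; first exact: num_real.
by move=> x Cx y _; apply: le_trans (fC y) (ltW Cx).
Qed.

Lemma bmf_cst (c : R) : bmf (fun=> c).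
Proof. by split; [exact: measurable_cst | exists `|c|]. Qed.

Lemma bmfD f g : bmf f -> bmf g -> bmf (fun x => f x + g x).
Proof.
move=> [mf [C fC]] [mg [D gD]]; split; first exact: measurable_funD.
by exists (C + D) => x; apply: le_trans (ler_normD _ _) _; exact: lerD.
Qed.

Lemma bmfM f g : bmf f -> bmf g -> bmf (fun x => f x * g x).
Proof.
move=> [mf [C fC]] [mg [D gD]]; split; first exact: measurable_funM.
by exists (C * D) => x; rewrite normrM; exact: ler_pM.
Qed.

Lemma bmfN f : bmf f -> bmf (fun x => - f x).
Proof.
move=> [mf [C fC]]; split; first exact: measurable_funN.
by exists C => x; rewrite normrN.
Qed.

Lemma bmfB f g : bmf f -> bmf g -> bmf (fun x => f x - g x).
Proof. by move=> bf bg; apply: bmfD => //; exact: bmfN. Qed.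

Lemma bmf_indic (A : set T) : measurable A -> bmf (\1_A).
Proof.
move=> mA; split; first exact: measurable_indic.
exists 1 => x; rewrite indicE; case: (_ \in _); rewrite ?normr1 ?normr0//.
Qed.

Lemma Rintegral_indicT (A : set T) : measurable A ->
  Rintegral P setT (\1_A : T -> R) = pr P A.
Proof. by move=> mA; rewrite /Rintegral integral_indic// setIT. Qed.

(** The common linearity rule for integrals; integrands below carry factors such as [1 *] or [-1 *]
    to fit this shape. *)
Lemma bmf_lin2 (a b : R) f g : bmf f -> bmf g ->
  Rintegral P setT (fun x => a * f x + b * g x) =
  a * Rintegral P setT f + b * Rintegral P setT g.
Proof.
move=> bf bg; rewrite RintegralD//; last 2 first.
- by apply: bmf_integrable; apply: bmfM => //; exact: bmf_cst.
- by apply: bmf_integrable; apply: bmfM => //; exact: bmf_cst.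
by rewrite !RintegralZl//; exact: bmf_integrable.
Qed.

Lemma bmf_le f g : bmf f -> bmf g -> (forall x, f x <= g x) ->
  Rintegral P setT f <= Rintegral P setT g.
Proof.
by move=> bf bg fg; apply: le_Rintegral => //; exact: bmf_integrable.
Qed.

End BoundedMeasurable.

(** * Birkhoff sums: maximal inequalities, convergence, windows *)

Section Birkhoff.
Context d (T : measurableType d) (R : realType) (P : probability T R).
Variable tau : T -> T.
Hypothesis mp : measure_preserving P tau.
Implicit Types f g : T -> R.

Let mtau : measurable_fun setT tau := mp.1.

Lemma measurable_iter n : measurable_fun setT (fun x => iter n tau x).
Proof.
by elim: n => [|n IH]; [exact: measurable_id | exact: (measurableT_comp mtau IH)].
Qed.

Lemma pr_preim (A : set T) : measurable A -> pr P (tau @^-1` A) = pr P A.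
Proof. by move=> mA; rewrite /pr mp.2. Qed.

Lemma bmf_comp f : bmf f -> bmf (fun x => f (tau x)).
Proof.
by move=> [mf [C fC]]; split; [exact: (measurableT_comp mf mtau) | exists C].
Qed.

Lemma Rintegral_comp f : bmf f ->
  Rintegral P setT (fun x => f (tau x)) = Rintegral P setT f.
Proof.
move=> bf; rewrite /Rintegral; congr fine.
rewrite -[LHS](@integral_pushforward _ _ _ _ _ _ mtau P setT (EFin \o f))//; last first.
- by rewrite preimage_setT; exact: bmf_integrable (bmf_comp bf).
- by apply/measurable_EFinP; case: bf.
by apply: eq_measure_integral => A mA _; exact: mp.2.
Qed.

Definition birk f n x := \sum_(i < n) f (iter i tau x).

Lemma birkS f n x : birk f n.+1 x = f x + birk f n (tau x).
Proof.
rewrite /birk big_ord_recl /=; congr (_ + _); apply: eq_bigr => i _.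
by rewrite -iterSr.
Qed.

Lemma birkSr f n x : birk f n.+1 x = birk f n x + f (iter n tau x).
Proof. by rewrite /birk big_ord_recr. Qed.

Lemma measurable_birk f n : measurable_fun setT f ->
  measurable_fun setT (birk f n).
Proof.
move=> mf; elim: n => [|n IH].
  rewrite (_ : birk f 0 = fun=> 0); first exact: measurable_cst.
  by apply/funext => x; rewrite /birk big_ord0.
rewrite (_ : birk f n.+1 = fun x => birk f n x + f (iter n tau x)).
  by apply: measurable_funD => //; exact: (measurableT_comp mf (measurable_iter n)).
by apply/funext => x; rewrite birkSr.
Qed.

Lemma birk_tau f n x (C : R) : (forall x, `|f x| <= C) ->
  `|birk f n (tau x) - birk f n x| <= C + C.
Proof.
move=> fC.
have -> : birk f n (tau x) - birk f n x = f (iter n tau x) - f x.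
  by have := birkS f n x; rewrite birkSr => h; lra.
by apply: le_trans (ler_normB _ _) _; exact: lerD.
Qed.

Lemma birkB f g n x : birk (fun x => f x - g x) n x = birk f n x - birk g n x.
Proof. by rewrite /birk sumrB. Qed.

Lemma birkN f n x : birk (fun x => - f x) n x = - birk f n x.
Proof. by rewrite /birk sumrN. Qed.

Lemma birk_cst (c : R) n x : birk (fun=> c) n x = c * n%:R.
Proof. by rewrite /birk sumr_const card_ord mulr_natr. Qed.

(** The largest of the sums [birk f k] with [k <= n], the empty sum included. The recursion through
    [tau] is the identity behind Garsia's inequality. *)
Fixpoint birk_max f n x :=
  if n is n'.+1 then Num.max 0 (f x + birk_max f n' (tau x)) else 0.

Lemma birk_maxP f n x :
  (exists2 k, (k <= n)%N & birk_max f n x = birk f k x) /\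
  (forall k, (k <= n)%N -> birk f k x <= birk_max f n x).
Proof.
elim: n x => [|n IH] x /=.
  by split; [exists 0%N; rewrite // /birk big_ord0 | move=> [|//] _; rewrite /birk big_ord0].
have [[k kn kE] kmax] := IH (tau x); split.
  have [h|h] := leP 0 (f x + birk_max f n (tau x)).
    by exists k.+1 => //; rewrite kE birkS.
  by exists 0%N => //; rewrite /birk big_ord0.
move=> [|j] jn; first by rewrite /birk big_ord0 le_max lexx.
by rewrite birkS le_max lerD2l kmax ?orbT.
Qed.

Lemma birk_max_ge0 f n x : 0 <= birk_max f n x.
Proof. by case: n => //= n; rewrite le_max lexx. Qed.

Lemma birk_max_leS f n x : birk_max f n x <= birk_max f n.+1 x.
Proof.
have [[k kn ->] _] := birk_maxP f n x.
by have [_] := birk_maxP f n.+1 x; apply; exact: leqW.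
Qed.

Lemma birk_max_gt0 f n x :
  0 < birk_max f n x <-> exists2 k, (k <= n)%N & 0 < birk f k x.
Proof.
have [[k kn kE] kmax] := birk_maxP f n x; split.
  by rewrite kE => h; exists k.
by move=> [j jn /lt_le_trans]; apply; exact: kmax.
Qed.

Lemma bmf_birk_max f n : bmf f -> bmf (birk_max f n).
Proof.
move=> bf; elim: n => [|n IH] /=; first exact: bmf_cst.
have [mg [C gC]] := bmfD bf (bmf_comp IH); split.
  by apply: measurable_maxr => //; exact: measurable_cst.
exists C => x; apply: le_trans (gC x); rewrite maxEle.
by case: ifP => // _; rewrite normr0.
Qed.

(* Garsia: M_n - M_n o tau <= f on {M_n > 0}, and the left-hand side integrates to 0. *)
Lemma maximal_ergodic_fin f n : bmf f ->
  0 <= Rintegral P setT (fun x => f x * \1_[set x | 0 < birk_max f n x] x).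
Proof.
move=> bf; have bM := bmf_birk_max n bf.
have mE : measurable [set x | 0 < birk_max f n x].
  by apply: measurable_lt_fun; [exact: measurable_cst | case: bM].
apply: le_trans (_ : Rintegral P setT (fun x => 1 * birk_max f n x +
    -1 * birk_max f n (tau x)) <= _).
  by rewrite bmf_lin2//; [rewrite Rintegral_comp// mul1r mulN1r subrr | exact: bmf_comp].
apply: bmf_le.
- apply: bmfD; apply: bmfM => //; try exact: bmf_cst; exact: bmf_comp.
- by apply: bmfM => //; exact: bmf_indic.
move=> x; rewrite indicE mul1r mulN1r.
have [h|/negP h] := boolP (x \in [set x | 0 < birk_max f n x]).
  rewrite inE /= in h; rewrite mulr1.
  case: n h {bM mE} => [|n] /=; first by rewrite ltxx.
  rewrite lt_max ltxx /= => h; rewrite max_r ?(ltW h)// lerBlDr lerD2l.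
  exact: birk_max_leS.
have {}h : birk_max f n x <= 0 by rewrite leNgt; apply/negP => ?; apply: h; rewrite inE.
rewrite mulr0 subr_le0; apply: le_trans h (birk_max_ge0 _ _ _).
Qed.

Lemma measurable_birk_pos f : measurable_fun setT f ->
  measurable [set x | exists k, 0 < birk f k x].
Proof.
move=> mf; apply: measurable_exists => k.
by apply: measurable_lt_fun; [exact: measurable_cst | exact: measurable_birk].
Qed.

(** Passage to the limit: the sets where the n-th maximum is positive exhaust the set of interest,
    and since [f] is bounded the missing part costs at most a multiple of its measure. *)
Lemma maximal_ergodic f : bmf f ->
  0 <= Rintegral P setT (fun x => f x * \1_[set x | exists k, 0 < birk f k x] x).
Proof.
move=> bf; have [mf [C fC]] := bf.
set E := [set x | _]; have mE : measurable E by exact: measurable_birk_pos.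
pose En n := [set x | 0 < birk_max f n x].
have mEn n : measurable (En n).
  by apply: measurable_lt_fun; [exact: measurable_cst | case: (bmf_birk_max n bf)].
have EnE n : En n `<=` E by move=> x /birk_max_gt0[k _ h]; exists k.
have key n : - (`|C| * pr P (E `\` En n)) <= Rintegral P setT (fun x => f x * \1_E x).
  have mD : measurable (E `\` En n) by exact: measurableD.
  apply: le_trans (_ : Rintegral P setT (fun x => 1 * (f x * \1_(En n) x) +
     - `|C| * \1_(E `\` En n) x) <= _).
    rewrite bmf_lin2//; [|by apply: bmfM => //; exact: bmf_indic|exact: bmf_indic].
    by rewrite Rintegral_indicT// mul1r mulNr lerDr; exact: maximal_ergodic_fin.
  apply: bmf_le.
  - apply: bmfD; apply: bmfM; try exact: bmf_cst; try exact: bmf_indic.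
    by apply: bmfM => //; exact: bmf_indic.
  - by apply: bmfM => //; exact: bmf_indic.
  move=> x; rewrite !indicE in_setD mul1r.
  have [/set_mem h|h] := boolP (x \in En n).
    by rewrite (mem_set (EnE _ _ h)) /= !mulr1 mulr0 addr0.
  rewrite andbT mulr0 add0r; case: (x \in E); rewrite ?mulr1 ?mulr0//.
  rewrite lerNl; apply: le_trans (ler_norm _) _; rewrite normrN.
  by apply: le_trans (fC x) (ler_norm _).
(* A negative integral would beat the error bound for some [n]; the [+ 1] keeps the divisor
   positive. *)
rewrite leNgt; apply/negP => h.
have [||||n nP] := @pr_cap0 _ _ _ P (fun n => E `\` En n)
  (- Rintegral P setT (fun x => f x * \1_E x) / (`|C| + 1)).
- by move=> n; exact: measurableD.
- move=> n x [Ex nEn]; split=> // En0; apply: nEn; rewrite /En /=.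
  by apply: lt_le_trans En0 (birk_max_leS _ _ _).
- apply: aeW => x; have [[k kx]|nE] := pselect (E x); last by exists 0%N => -[].
  by exists k => -[_]; apply; apply/birk_max_gt0; exists k.
- by rewrite divr_gt0 ?oppr_gt0// ltr_wpDl.
have := key n; rewrite leNgt => /negP; apply.
rewrite ltrNr; rewrite ltr_pdivlMr ?ltr_wpDl// in nP.
apply: le_lt_trans nP; rewrite mulrC ler_wpM2l ?pr_ge0// lerDl//.
Qed.

(** The maximal theorem for [f - c]: the integral of [f] over the exceptional set is at least [c]
    times its measure, and [f >= 0] extends the integral to the whole space. *)
Lemma maximal_inequality f (c : R) : bmf f -> (forall x, 0 <= f x) -> 0 <= c ->
  c * pr P [set x | exists k, c * k%:R < birk f k x] <= Rintegral P setT f.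
Proof.
move=> bf f0 c0; have bc := bmf_cst T c.
have := maximal_ergodic (bmfB bf bc).
have -> : [set x | exists k, 0 < birk (fun x => f x - c) k x] =
   [set x | exists k, c * k%:R < birk f k x].
  by apply/seteqP; split=> x [k h]; exists k; move: h; rewrite birkB birk_cst subr_gt0.
set E := [set x | _].
have mE : measurable E.
  apply: measurable_exists => k; apply: measurable_lt_fun; first exact: measurable_cst.
  by case: bf => mf _; exact: measurable_birk.
have bE := bmf_indic R mE.
have -> : (fun x => (f x - c) * \1_E x) = (fun x => 1 * (f x * \1_E x) + - c * \1_E x).
  by apply/funext => x; rewrite mul1r mulrBl mulNr.
rewrite bmf_lin2//; last exact: bmfM.
rewrite mul1r mulNr subr_ge0 Rintegral_indicT// => /le_trans; apply.
apply: bmf_le => //; first exact: bmfM.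
by move=> x; rewrite indicE; case: (_ \in _); rewrite ?mulr1 ?mulr0.
Qed.

(** For [f * \1_E] with [E] invariant, the sums are those of [f] on [E] and zero off it, so the set
    where one of them is positive is [E] itself. *)
Lemma maximal_invariant f (E : set T) : bmf f -> measurable E ->
  (forall x, E (tau x) <-> E x) -> (forall x, E x -> exists k, 0 < birk f k x) ->
  0 <= Rintegral P setT (fun x => f x * \1_E x).
Proof.
move=> bf mE iE Epos; have bE := bmf_indic R mE.
have := maximal_ergodic (bmfM bf bE).
have iterE k x : \1_E (iter k tau x) = \1_E x :> R.
  elim: k => //= k <-; rewrite !indicE; congr (_%:R); apply: congr1.
  by apply/idP/idP; rewrite !inE => /iE.
have birkE k x : birk (fun x => f x * \1_E x) k x = birk f k x * \1_E x.
  by rewrite /birk big_distrl /=; apply: eq_bigr => i _; rewrite iterE.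
set F := [set x | _]; have -> : F = E.
  apply/seteqP; split=> x.
    move=> [k]; rewrite birkE indicE; case: (boolP (x \in E)) => [/set_mem//|_].
    by rewrite mulr0 ltxx.
  by move=> Ex; have [k kx] := Epos _ Ex; exists k; rewrite birkE indicE mem_set ?mulr1.
congr (0 <= _); apply: eq_Rintegral => x _ /=.
by rewrite indicE; case: (_ \in _); rewrite ?mulr1 ?mulr0.
Qed.

(* limsup (birk f n x / n) > b *)
Definition birk_above f b : set T := [set x | exists k : nat, forall N : nat,
  exists n : nat, (N <= n)%N /\ n%:R * (b + k.+1%:R^-1) < birk f n x].

Lemma measurable_birk_above f b : measurable_fun setT f ->
  measurable (birk_above f b).
Proof.
move=> mf; apply: measurable_exists => k; apply: measurable_forall => N.
apply: measurable_exists => n; apply: measurable_conjl.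
by apply: measurable_lt_fun; [exact: measurable_cst | exact: measurable_birk].
Qed.

Lemma birk_above_pos f b x : birk_above f b x -> exists k, 0 < birk (fun x => f x - b) k x.
Proof.
move=> [k /(_ 0%N)[n [_ h]]]; exists n; rewrite birkB birk_cst subr_gt0.
apply: le_lt_trans h; rewrite mulrC ler_wpM2l// lerDl invr_ge0//.
Qed.

(** Half of the margin [1 / (k + 1)], that is index [2 * k + 1], absorbs a bounded difference once
    [n] is large. Hence the condition is invariant under [tau] at every point. *)
Lemma birk_above_close f b x y (C : R) :
  (forall n, `|birk f n y - birk f n x| <= C) -> birk_above f b x -> birk_above f b y.
Proof.
move=> fC [k kP]; exists (2 * k + 1)%N => N.
have [m mP] : exists m : nat, C * (2 * (k.+1)%:R) <= m%:R.
  by exists (Num.truncn (C * (2 * (k.+1)%:R))).+1; apply/ltW; exact: truncnS_gt.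
have [n [Nn nP]] := kP (maxn N m); exists n; split.
  by apply: leq_trans Nn; exact: leq_maxl.
have mn : (m%:R : R) <= n%:R by rewrite ler_nat; apply: leq_trans Nn; exact: leq_maxr.
have := fC n; rewrite ler_norml => /andP[h _].
set q := (k.+1%:R)^-1 in nP.
have qk : q * k.+1%:R = 1 by rewrite mulVf.
have -> : ((2 * k + 1).+1%:R)^-1 = q / 2 :> R.
  rewrite /q -invfM; congr (_^-1); rewrite -[in RHS](natrM _ k.+1 2); congr (_%:R).
  by rewrite addn1 mulnC mulSn.
have q0 : 0 < q by rewrite invr_gt0.
have hC : C <= n%:R * (q / 2).
  have : C * (2 * k.+1%:R) * (q / 2) <= n%:R * (q / 2).
    by rewrite ler_pM2r ?divr_gt0//; exact: le_trans mn.
  have -> : C * (2 * k.+1%:R) * (q / 2) = C * (q * k.+1%:R) by field.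
  by rewrite qk mulr1.
move: nP; rewrite !mulrDr => nP.
have q2 : n%:R * q = n%:R * (q / 2) + n%:R * (q / 2) by field.
lra.
Qed.

Lemma birk_above_inv f b x : bmf f -> birk_above f b (tau x) <-> birk_above f b x.
Proof.
move=> [_ [C fC]]; split; apply: (@birk_above_close _ _ _ _ (C + C)) => n.
  by rewrite distrC; exact: birk_tau.
exact: birk_tau.
Qed.

(** On the invariant set of points with upper limit above [b] and lower limit below [a], both
    [f - b] and [a - f] have non-negative integral; adding them gives [0 <= (a - b) * pr P E] with
    [a - b < 0]. *)
Lemma birk_gap f (a b : R) : bmf f -> a < b ->
  {ae P, forall x, ~ (birk_above f b x /\ birk_above (fun x => - f x) (- a) x)}.
Proof.
move=> bf ab; have bfN := bmfN bf.
have [[mf _] [mfN _]] := (bf, bfN).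
set E := birk_above f b `&` birk_above (fun x => - f x) (- a).
have mE : measurable E by apply: measurableI; exact: measurable_birk_above.
have iE x : E (tau x) <-> E x.
  by split=> -[/(birk_above_inv _ _ bf) ? /(birk_above_inv _ _ bfN) ?].
have bE := bmf_indic R mE.
apply: ae_pr0 => //; apply/eqP; rewrite eq_le pr_ge0 andbT.
have h1 : 0 <= Rintegral P setT (fun x => (f x - b) * \1_E x).
  apply: maximal_invariant => //; first by apply: bmfB => //; exact: bmf_cst.
  by move=> x [/birk_above_pos].
have h2 : 0 <= Rintegral P setT (fun x => (- f x - - a) * \1_E x).
  apply: maximal_invariant => //; first by apply: bmfB => //; exact: bmf_cst.
  by move=> x [_ /birk_above_pos].
have : 0 <= (a - b) * pr P E.
  rewrite -Rintegral_indicT// -[leRHS]addr0 -[X in _ + X](mul0r (Rintegral P setT \1_E)).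
  rewrite -bmf_lin2//.
  have := addr_ge0 h1 h2.
  rewrite -[X in X + _]mul1r -[X in _ + X]mul1r -bmf_lin2.
  - congr (0 <= _); apply: eq_Rintegral => x _; ring.
  - by apply: bmfM => //; apply: bmfB => //; exact: bmf_cst.
  - by apply: bmfM => //; apply: bmfB => //; exact: bmf_cst.
by rewrite nmulr_rge0// subr_lt0.
Qed.

(** All rational gaps between lower and upper limit are excluded at once. The estimate is multiplied
    by [n] to avoid a division. *)
Lemma birkhoff_cvg f : bmf f ->
  {ae P, forall x, exists l : R, forall e, 0 < e -> exists N : nat,
     forall n, (N <= n)%N -> `|birk f n x - l * n%:R| <= e * n%:R}.
Proof.
move=> bf; have [_ [C fC]] := bf.
have : {ae P, forall x, forall n : nat, if unpickle n is Some ab then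
    let a : R := ratr (ab.1 : rat) in let b : R := ratr (ab.2 : rat) in
    a < b -> ~ (birk_above f b x /\ birk_above (fun x => - f x) (- a) x) else True}.
  apply/ae_foralln => n; case: (unpickle n) => [[a b]|]; last exact: aeW.
  have [ab|ab] := boolP ((ratr a : R) < ratr b); last first.
    by apply: aeW => x /=; rewrite (negbTE ab).
  by apply: filterS (birk_gap bf ab).
apply: filterS => x gap.
have {}gap (a b : rat) : (ratr a : R) < ratr b ->
    ~ (birk_above f (ratr b) x /\ birk_above (fun x => - f x) (- ratr a) x).
  by move: (gap (pickle (a, b))); rewrite pickleK.
(* Its supremum is the upper limit of the averages. *)
pose S := [set r : R | forall N : nat, exists n : nat, (N <= n)%N /\ r * n%:R <= birk f n x].
have birkC n : `|birk f n x| <= C * n%:R.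
  apply: le_trans (ler_norm_sum _ _ _) _; rewrite mulr_natr -[X in _ *+ X]card_ord -sumr_const.
  exact: ler_sum.
have SC : has_sup S.
  split; first (exists (- C) => N; exists N; split=> //).
    by rewrite mulNr; have := birkC N; rewrite ler_norml => /andP[].
  exists C => r /(_ 1%N)[n [n1 rn]].
  have n0 : (0 : R) < n%:R by rewrite ltr0n.
  rewrite -(ler_pM2r n0); apply: le_trans rn _; apply: le_trans (birkC n); exact: ler_norm.
exists (sup S) => e e0.
have [N1 N1P] : exists N, forall n, (N <= n)%N -> birk f n x <= (sup S + e) * n%:R.
  apply: contrapT => h.
  have /(ub_le_sup SC.2) : S (sup S + e).
    move=> N; apply: contrapT => hN; apply: h; exists N => n Nn.
    by apply/ltW; rewrite ltNge; apply/negP => k; apply: hN; exists n.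
  by rewrite gerDl leNgt e0.
(* Averages below [sup S - e] infinitely often would leave rationals [a < b] strictly between
   [sup S - e] and [sup S], a forbidden gap. *)
have [N2 N2P] : exists N, forall n, (N <= n)%N -> (sup S - e) * n%:R <= birk f n x.
  apply: contrapT => h.
  have [a] := @rat_in_itvoo R (sup S - e) (sup S) (ltac:(rewrite ltrBlDr ltrDl//)).
  rewrite in_itv /= => /andP[ea ale].
  have [b] := @rat_in_itvoo R (ratr a) (sup S) ale.
  rewrite in_itv /= => /andP[ab ble].
  apply: (gap a b ab); split.
    have [r Sr br] := sup_adherent (ltac:(by rewrite subr_gt0) : 0 < sup S - ratr b) SC.
    rewrite opprB addrCA subrr addr0 in br.
    have [k kP] : exists k : nat, k.+1%:R^-1 < r - ratr b.
      have br' : 0 < r - ratr b by rewrite subr_gt0.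
      exists (Num.truncn (r - ratr b)^-1); rewrite invf_plt ?posrE//; exact: truncnS_gt.
    exists k => N; have [n [Nn rn]] := Sr N.+1; exists n; split; first exact: ltnW.
    apply: lt_le_trans rn; rewrite mulrC ltr_pM2r; first by rewrite -ltrBrDl.
    by rewrite ltr0n; exact: leq_trans Nn.
  have [k kP] : exists k : nat, k.+1%:R^-1 < ratr a - (sup S - e).
    have br' : 0 < ratr a - (sup S - e) by rewrite subr_gt0.
    exists (Num.truncn (ratr a - (sup S - e))^-1); rewrite invf_plt ?posrE//; exact: truncnS_gt.
  exists k => N; apply: contrapT => hN; apply: h; exists N => n Nn.
  rewrite leNgt; apply/negP => hlt; apply: hN; exists n; split=> //.
  rewrite birkN; apply: le_lt_trans (_ : - ((sup S - e) * n%:R) < _); last by rewrite ltrN2.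
  rewrite -(mulNr (sup S - e)) mulrC; apply: ler_wpM2r => //.
  by rewrite -lerBrDl opprK addrC ltW.
exists (maxn N1 N2) => n; rewrite geq_max => /andP[n1 n2].
have := N1P n n1; have := N2P n n2; rewrite ler_norml mulrBl mulrDl => ? ?.
apply/andP; split; lra.
Qed.

(** The window sum is a difference of two initial sums, so it is about [l * (L + 1)] with an error
    proportional to [M + L], hence to [L]. The limit [l] is at most 1/8 off the set where some
    average exceeds 1/8, and the maximal inequality bounds that set by [8 * pr P B]; the summand [e]
    pays for a uniform threshold. *)
Lemma birk_window (B : set T) (kappa e : R) : measurable B -> 0 < kappa -> 0 < e ->
  exists N : nat, exists Q : set T, [/\ measurable Q,
    1 - 8 * pr P B < pr P Q + e &
    forall x, Q x -> forall M L : nat, (N <= M)%N -> (N <= L)%N -> kappa <= L%:R / M%:R ->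
      birk \1_B (M + L.+1) x - birk \1_B M x <= L%:R / 4].
Proof.
move=> mB k0 e0; have bB := bmf_indic R mB.
pose Q N : set T := [set x | forall M L : nat, (N <= M)%N -> (N <= L)%N ->
  kappa <= L%:R / M%:R -> birk \1_B (M + L.+1) x - birk \1_B M x <= L%:R / 4].
pose A := [set x | exists k, 8^-1 * k%:R < birk \1_B k x].
have mb n : measurable_fun setT (birk \1_B n) by apply: measurable_birk; case: bB.
have mA : measurable A.
  apply: measurable_exists => k; apply: measurable_lt_fun => //; exact: measurable_cst.
have mQ N : measurable (Q N).
  apply: measurable_forall => M; apply: measurable_forall => L.
  do 3 apply: measurable_impl.
  by apply: measurable_le_fun; [exact: measurable_funB | exact: measurable_cst].
have prA : 1 - 8 * pr P B <= pr P (~` A).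
  rewrite prC// lerD2l lerN2.
  have := @maximal_inequality \1_B 8^-1 bB _ _.
  rewrite Rintegral_indicT// -/A => h.
  have {}h : 8^-1 * pr P A <= pr P B by apply: h => // x; rewrite indicE.
  lra.
have [|||n hn] := @pr_cup1 _ _ _ P Q (~` A) e _ mQ _ _ e0.
- exact: measurableC.
- by move=> n x h M L nM nL; apply: h; exact: ltnW.
- apply: filterS (birkhoff_cvg bB) => x [l cv] nA.
  have lb k : birk \1_B k x <= 8^-1 * k%:R.
    by rewrite leNgt; apply/negP => h; apply: nA; exists k.
  (* Chosen so that [th * (2 * M + L + 1) <= L / 16] when [M <= L / kappa] and [1 <= L]. *)
  pose th : R := 16^-1 / (2 / kappa + 2).
  have k1 : 0 < kappa^-1 by rewrite invr_gt0.
  have thd : 0 < 2 / kappa + 2 by rewrite addr_gt0// divr_gt0.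
  have th0 : 0 < th by rewrite divr_gt0.
  have [N NP] := cv th th0.
  have l8 : l <= 8^-1.
    rewrite leNgt; apply/negP => hl.
    have [N' N'P] := cv ((l - 8^-1) / 2) (ltac:(by rewrite divr_gt0// subr_gt0)).
    have := N'P N'.+1 (leqnSn _); rewrite ler_norml => /andP[h _].
    have := lb N'.+1; have n0 : (0 : R) < N'.+1%:R by [].
    move: h; set n := N'.+1%:R in n0 *; set b := birk _ _ _ => h1 h2.
    have : 0 < (l - 8^-1) / 2 * n by rewrite mulr_gt0// divr_gt0// subr_gt0.
    have e1 : l * n = 2 * ((l - 8^-1) / 2 * n) + 8^-1 * n by field.
    lra.
  (* For [2 <= L], [(L + 1) / 8 <= 3 * L / 16], and the error [L / 16] completes [L / 4]. *)
  exists (maxn N 2) => M L; rewrite !geq_max => /andP[NM M2] /andP[NL L2] kLM.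
  have := NP M NM; rewrite ler_norml => /andP[h1 _].
  have := NP (M + L.+1)%N (leq_trans NM (leq_addr _ _)); rewrite ler_norml => /andP[_ h2].
  move: h1 h2; set bM := birk _ M x; set bL := birk _ _ x.
  rewrite natrD -(natr1 L); set m : R := M%:R; set r : R := L%:R => h1 h2.
  have r2 : 2 <= r by rewrite /r (ler_nat R 2%N L).
  have m0 : 0 < m by rewrite /m ltr0n; exact: leq_trans M2.
  have mr : m <= r / kappa.
    by rewrite ler_pdivlMr// mulrC -ler_pdivlMr.
  have hth : th * (2 / kappa + 2) = 16^-1 by rewrite /th divfK// gt_eqF.
  have A1 : th * (2 * m + r + 1) <= r / 16.
    have -> : r / 16 = th * (2 * (r / kappa) + 2 * r).
      by rewrite -hth; ring.
    by rewrite ler_pM2l//; lra.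
  have A2 : l * (r + 1) <= 8^-1 * (r + 1) by rewrite ler_pM2r//; lra.
  have E1 : l * (m + (r + 1)) = l * m + l * (r + 1) by ring.
  have E2 : th * (m + (r + 1)) = th * (2 * m + r + 1) - th * m by ring.
  lra.
by exists n, (Q n); split=> //; apply: le_lt_trans hn.
Qed.

Lemma count_birk (B : set T) (p : nat -> bool) (M L : nat) x :
  (forall n, p n -> B (iter n tau x)) ->
  (count p (iota M L))%:R <= birk \1_B (M + L) x - birk \1_B M x :> R.
Proof.
move=> pB; elim: L M => [|L IH] M /=; first by rewrite addn0 subrr.
rewrite natrD addnS -addSn.
apply: le_trans (_ : _ <= \1_B (iter M tau x) +
   (birk \1_B (M.+1 + L) x - birk \1_B M.+1 x)) _.
  apply: lerD (IH _); rewrite indicE ler_nat; case: (boolP (p M)) => // /pB h.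
  by rewrite mem_set.
by rewrite (birkSr _ M); lra.
Qed.

End Birkhoff.

(** * Measurability in separable metric spaces *)

Section MetricMeasurability.
Context (R : realType) dY (Y : measurableType dY) (dist : Y -> Y -> R).
Hypothesis Hmet : is_metric dist.
Hypothesis Hborel : @measurable dY Y = dborel dist.

Let dist_sym x y : dist x y = dist y x.
Proof. by case: Hmet. Qed.
Let dist_tri x y z : dist x z <= dist x y + dist y z.
Proof. by case: Hmet. Qed.

Lemma dist_refl x : dist x x = 0.
Proof. by case: Hmet => _ h _ _; apply/h. Qed.

Lemma dist_gt0 x y : x <> y -> 0 < dist x y.
Proof.
case: Hmet => h0 h _ _ xy; rewrite lt_neqAle h0 andbT eq_sym; apply/eqP => d0.
by apply: xy; apply/h.
Qed.

Lemma dopen_ball x r : dopen dist [set y | dist x y < r].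
Proof.
move=> y /= xy; exists (r - dist x y); first by rewrite subr_gt0.
move=> z; rewrite ltrBrDl; apply: le_lt_trans; exact: dist_tri.
Qed.

Lemma measurable_dball x r : measurable [set y | dist x y < r].
Proof. by rewrite Hborel; apply: sub_sigma_algebra; exact: dopen_ball. Qed.

Section Separable.
Hypothesis Hsc : dsigma_compact dist.

Lemma dcompact_net (K : set Y) (r : R) : dcompact dist K -> 0 < r ->
  exists s : seq Y, forall x, K x -> exists2 c, List.In c s & dist c x < r.
Proof.
move=> cK r0.
have [||s [sF sK]] := cK [set A | exists c, A = [set y | dist c y < r]].
- by move=> A [c ->]; exact: dopen_ball.
- by move=> x Kx; exists [set y | dist x y < r]; [exists x | rewrite /= dist_refl].
have [t tP] : exists t : seq Y, forall A, List.In A s ->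
    exists2 c, List.In c t & A = [set y | dist c y < r].
  elim: s sF {sK} => [|A s IH] sF; first by exists [::].
  have [t tP] := IH (fun B h => sF B (or_intror h)).
  have [c cE] := sF A (or_introl erefl).
  exists (c :: t) => B /= [<-|/tP[c' c't ->]]; first by exists c => //; left.
  by exists c' => //; right.
exists t => x /sK[A /tP[c ct ->] /= h]; by exists c.
Qed.

(** Finite nets of the compact pieces at the radii [1 / (m + 1)] form a countable dense set; [y0]
    fills the indices that decode to nothing. *)
Lemma sigma_compact_separable (y0 : Y) : dseparable dist.
Proof.
have [K [cK coverK]] := Hsc.
have /choice[t tP] : forall nm : nat * nat, exists s : seq Y, forall x, K nm.1 x ->
    exists2 c, List.In c s & dist c x < (nm.2.+1)%:R^-1.
  by move=> [n m]; apply: dcompact_net.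
exists (fun k => if unpickle k is Some nmi then
  nth y0 (t (nmi : (nat * nat) * nat).1) nmi.2 else y0) => x e e0.
have [n Kn] := coverK x.
have [c ct cx] := tP (n, Num.truncn e^-1) x Kn.
have [i ic] : exists i, nth y0 (t (n, Num.truncn e^-1)) i = c.
  elim: (t _) ct => //= a s IH [->|/IH[i ic]]; first by exists 0%N.
  by exists i.+1.
exists (pickle ((n, Num.truncn e^-1), i)); rewrite pickleK /= ic dist_sym.
by apply: lt_trans cx _; rewrite invf_plt ?posrE//; exact: truncnS_gt.
Qed.

End Separable.

Variable u : nat -> Y.
Hypothesis udense : forall x (e : R), 0 < e -> exists n, dist x (u n) < e.

(** A dense point near [f z] and a rational splitting of [r] decouple [f] from [g], so only balls
    around fixed centres are pulled back. *)
Lemma measurable_dist_lt d (T : measurableType d) (f g : T -> Y) (r : R) :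
  measurable_fun setT f -> measurable_fun setT g ->
  measurable [set z | dist (f z) (g z) < r].
Proof.
move=> mf mg.
have -> : [set z | dist (f z) (g z) < r] = [set z | exists k : nat, exists q : rat,
    dist (u k) (f z) < ratr q /\ dist (u k) (g z) < r - ratr q].
  apply/seteqP; split=> z /=.
    move=> h; have h' : 0 < (r - dist (f z) (g z)) / 3 by rewrite divr_gt0// subr_gt0.
    set e := _ / 3 in h'; have [k kP] := udense (f z) h'; exists k.
    have [q] := @rat_in_itvoo R (dist (f z) (u k)) e kP.
    rewrite in_itv /= => /andP[q1 q2]; exists q; split; first by rewrite dist_sym.
    have := dist_tri (u k) (f z) (g z); rewrite (dist_sym (u k) (f z)) => h2.
    have : r = dist (f z) (g z) + 3 * e by rewrite /e; field.
    move: (ratr q) q1 q2 => q' q1 q2; lra.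
  move=> [k [q [h1 h2]]]; apply: le_lt_trans (dist_tri _ (u k) _) _.
  by rewrite dist_sym -[ltRHS](subrK (ratr q)) addrC; exact: ltrD.
apply: measurable_exists => k; apply: measurable_exists => q.
apply: measurable_conj; [apply: (measurable_preimT mf (B := [set y | dist (u k) y < ratr q]))
  | apply: (measurable_preimT mg (B := [set y | dist (u k) y < r - ratr q]))];
  exact: measurable_dball.
Qed.

Lemma measurable_dist_ge d (T : measurableType d) (f g : T -> Y) (r : R) :
  measurable_fun setT f -> measurable_fun setT g ->
  measurable [set z | r <= dist (f z) (g z)].
Proof.
move=> mf mg; rewrite (_ : [set z | _] = ~` [set z | dist (f z) (g z) < r]).
  by apply: measurableC; exact: measurable_dist_lt.
apply/seteqP; split=> z /=; first by rewrite leNgt => /negP.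
by move/negP; rewrite -leNgt.
Qed.

Definition ratball (i : nat * nat) : set Y := [set y | dist (u i.1) y < i.2.+1%:R^-1].

Lemma measurable_ratball i : measurable (ratball i).
Proof. exact: measurable_dball. Qed.

Lemma ratball_nbhs (A : set Y) x : dopen dist A -> A x ->
  exists2 i, ratball i x & ratball i `<=` A.
Proof.
move=> oA /oA[r r0 rA]; have r2 : 0 < r / 2 by rewrite divr_gt0.
pose m := Num.truncn (r / 2)^-1.
have mr : m.+1%:R^-1 < r / 2 by rewrite invf_plt ?posrE//; exact: truncnS_gt.
have [|k kx] := udense x (e := m.+1%:R^-1); first by rewrite invr_gt0.
exists (k, m); first by rewrite /ratball /= dist_sym.
move=> y /= h; apply: rA; apply: le_lt_trans (dist_tri _ (u k) _) _.
rewrite /ratball /= in h; set q := _^-1 in h kx mr.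
by rewrite [ltRHS]splitr; apply: ltrD; [exact: lt_trans kx _ | exact: lt_trans h _].
Qed.

Lemma ratball_separates x y : (forall i, ratball i x <-> ratball i y) -> x = y.
Proof.
move=> h; apply: contrapT => /dist_gt0 xy.
have [||i ix iA] := @ratball_nbhs [set z | dist x z < dist x y] x.
- exact: dopen_ball.
- by rewrite /= dist_refl.
by have /iA /= := (h i).1 ix; rewrite ltxx.
Qed.

End MetricMeasurability.

(** * Orbits of measurable flows *)

Section LebesgueShift.
Context (R : realType).
Notation lam := (@lebesgue_measure R).

Lemma measurable_shift (t : R) : measurable_fun setT (fun s : R => s + t).
Proof. by apply: measurable_funD; [exact: measurable_id | exact: measurable_cst]. Qed.

Lemma lebesgue_shift (t : R) (A : set R) : measurable A ->
  lam ((fun s => s + t) @^-1` A) = lam A.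
Proof.
move=> mA.
suff : pushforward lam ((fun s => s + t) : _ -> measurableTypeR R) A = lam A by [].
have mt := measurable_shift t.
apply/esym/lebesgue_measure_unique => //= _ [[a b]] _ <-.
rewrite /pushforward.
have -> : (fun s => s + t) @^-1` `]a, b]%classic = `](a - t), (b - t)]%classic.
  by apply/seteqP; split=> s /=; rewrite !in_itv /= ltrBlDr lerBrDr.
rewrite !lebesgue_measure_itv /= !lte_fin ltrD2r; case: ifP => // _.
by rewrite -!EFinB; congr (_%:E); ring.
Qed.
End LebesgueShift.

(** * Occupation times as coordinates along orbits *)

Section OccupationTime.
Context (R : realType) dY (Y : measurableType dY).
Variables (nu : probability Y R) (S : R -> Y -> Y).
Hypothesis flow : mp_flow nu S.
Notation lam := (@lebesgue_measure R).

Lemma flow0 x : S 0 x = x. Proof. by case: flow. Qed.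
Lemma flowD s t x : S (s + t) x = S s (S t x). Proof. by case: flow. Qed.
Lemma flowNK t x : S (- t) (S t x) = x. Proof. by rewrite -flowD addNr flow0. Qed.
Lemma flowKN t x : S t (S (- t) x) = x. Proof. by rewrite -flowD subrr flow0. Qed.
Lemma measurable_flow t : measurable_fun setT (S t).
Proof. by case: flow => _ _ mp _; case: (mp t). Qed.
Lemma pr_flow t (A : set Y) : measurable A -> pr nu (S t @^-1` A) = pr nu A.
Proof. by move=> mA; rewrite /pr; case: flow => _ _ mp _; rewrite (mp t).2. Qed.

Lemma measurable_flow_joint (B : set Y) : measurable B ->
  measurable [set p : Y * R | B (S p.2 p.1)].
Proof.
by move=> mB; case: flow => _ _ _ mS; apply: (measurable_preimT mS mB).
Qed.

Lemma xsection_setE (W : set (Y * R)) y : xsection W y = [set s | W (y, s)].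
Proof. by apply/seteqP; split=> s; rewrite /xsection /= inE. Qed.

Lemma measurable_visits (B : set Y) y : measurable B ->
  measurable [set s : R | B (S s y)].
Proof.
move=> mB; have := measurable_xsection y (measurable_flow_joint mB).
by rewrite xsection_setE.
Qed.

(* Unlike the indicator of B, this occupation time is Lipschitz along orbits. *)
Definition occ (B : set Y) (a b : R) (y : Y) : R :=
  fine (lam (`]a, b]%classic `&` [set s | B (S s y)])).

Lemma lam_oc (a b : R) : lam `]a, b]%classic = (Num.max 0 (b - a))%:E.
Proof.
rewrite lebesgue_measure_itv /= lte_fin; case: ltP => ab.
  by rewrite -EFinB max_r// subr_ge0 ltW.
by rewrite max_l// subr_le0.
Qed.

Lemma lam_oc_lty (a b : R) (E : set R) : measurable E ->
  (lam (`]a, b]%classic `&` E) < +oo)%E.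
Proof.
move=> mE; apply: le_lt_trans (_ : lam `]a, b]%classic < +oo)%E.
  by apply: le_measure; rewrite ?inE//; exact: measurableI.
by rewrite lam_oc ltry.
Qed.

Lemma occE B a b y : measurable B ->
  lam (`]a, b]%classic `&` [set s | B (S s y)]) = (occ B a b y)%:E.
Proof.
move=> mB; rewrite /occ fineK// ge0_fin_numE//.
by apply: lam_oc_lty; exact: measurable_visits.
Qed.

Lemma measurable_occ B a b : measurable B -> measurable_fun setT (occ B a b).
Proof.
move=> mB.
pose W := [set p : Y * R | `]a, b]%classic p.2 /\ B (S p.2 p.1)].
have mW : measurable W.
  apply: measurable_conj; last exact: measurable_flow_joint.
  exact: (measurable_preimT (@measurable_snd _ _ Y R)).
have -> : occ B a b = fine \o (lam \o xsection W).
  by apply/funext => y /=; rewrite xsection_setE.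
apply: measurableT_comp; first exact: fine_measurable.
exact: measurable_fun_xsection.
Qed.

Lemma occ_flow B a b t y : measurable B -> occ B a b (S t y) = occ B (a + t) (b + t) y.
Proof.
move=> mB; rewrite /occ -[in RHS](@lebesgue_shift _ t); last first.
  by apply: measurableI => //; exact: measurable_visits.
by congr (fine (lam _)); apply/seteqP; split=> s /=; rewrite !in_itv /= lerD2r ltrD2r flowD//.
Qed.

Lemma occ_le B a b a' b' y : measurable B ->
  occ B a b y <= occ B a' b' y + (`|a - a'| + `|b - b'|).
Proof.
move=> mB; have mE := measurable_visits y mB.
set E := [set s | _] in mE.
have n1 : 0 <= Num.max 0 (a' - a) <= `|a - a'|.
  by rewrite le_max lexx /= ge_max normr_ge0 /= distrC ler_norm.
have n2 : 0 <= Num.max 0 (b - b') <= `|b - b'|.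
  by rewrite le_max lexx /= ge_max normr_ge0 /= ler_norm.
rewrite -lee_fin !EFinD -!occE// -/E.
apply: (@le_trans _ _ (lam (`]a', b'] `&` E) + (lam `]a, a'] + lam `]b', b]))%E); last first.
  rewrite !lam_oc; apply: leeD2l; rewrite -!EFinD lee_fin; apply: lerD.
    by case/andP: n1.
  by case/andP: n2.
have mI : measurable (`]a', b'] `&` E) by exact: measurableI.
apply: (@le_trans _ _ (lam ((`]a', b'] `&` E) `|` (`]a, a'] `|` `]b', b])))).
  apply: le_measure; rewrite ?inE; [exact: measurableI|apply: measurableU => //; exact: measurableU|].
  move=> s [/= + Es]; rewrite in_itv /= => /andP[as_ sb].
  have [sa'|a's] := leP s a'; first by right; left; rewrite /= in_itv /= as_.
  have [sb'|b's] := leP s b'; first by left; split=> //=; rewrite in_itv /= a's.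
  by right; right; rewrite /= in_itv /= b's.
apply: le_trans (measureU2 _ _ _) _ => //; first exact: measurableU.
by apply: leeD2l; exact: measureU2.
Qed.

Lemma occ_lip B a b a' b' y : measurable B ->
  `|occ B a b y - occ B a' b' y| <= `|a - a'| + `|b - b'|.
Proof.
move=> mB; rewrite ler_norml; apply/andP; split.
  by rewrite lerBrDr addrC lerBlDr [`|a - _|]distrC [`|b - _|]distrC; exact: occ_le.
by rewrite lerBlDl; exact: occ_le.
Qed.

Lemma occ_orbit_lip B a b t t' y : measurable B ->
  `|occ B a b (S t y) - occ B a b (S t' y)| <= 2 * `|t - t'|.
Proof.
move=> mB; rewrite !occ_flow//; apply: le_trans (occ_lip _ _ _ _ _ mB) _.
have e c : c + t - (c + t') = t - t' by ring.
by rewrite !e mulr_natl mulr2n.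
Qed.

(** Equality extends from rational to real endpoints by the Lipschitz bound; then the restrictions
    of Lebesgue measure to the two visit sets agree on half-open intervals, hence on all measurable
    sets. *)
Lemma occ_eq_visits B y y' : measurable B ->
  (forall a b : rat, occ B (ratr a) (ratr b) y = occ B (ratr a) (ratr b) y') ->
  forall A : set R, measurable A ->
    lam (A `&` [set s | B (S s y)]) = lam (A `&` [set s | B (S s y')]).
Proof.
move=> mB h A mA.
have hr (a b : R) : occ B a b y = occ B a b y'.
  apply/eqP; rewrite -subr_eq0 -normr_le0; apply/ler_addgt0Pr => e e0; rewrite add0r.
  have e4 : 0 < e / 4 by rewrite divr_gt0.
  have [a1] := @rat_in_itvoo R a (a + e / 4) (ltac:(by rewrite ltrDl)).
  have [b1] := @rat_in_itvoo R b (b + e / 4) (ltac:(by rewrite ltrDl)).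
  rewrite !in_itv /= => /andP[b1l b1r] /andP[a1l a1r].
  have ha : `|a - ratr a1| <= e / 4.
    by rewrite ler_norml; apply/andP; move: (ratr a1 : R) a1l a1r => q ? ?; split; lra.
  have hb : `|b - ratr b1| <= e / 4.
    by rewrite ler_norml; apply/andP; move: (ratr b1 : R) b1l b1r => q ? ?; split; lra.
  have h1 := occ_lip a b (ratr a1) (ratr b1) y mB.
  have := occ_lip a b (ratr a1) (ratr b1) y' mB; rewrite -h => h2.
  move: h1 h2 ha hb; rewrite ler_norml => /andP[h1 h1'] ; rewrite ler_norml => /andP[h2 h2'].
  move: (`|a - _|) (`|b - _|) h1 h1' h2 h2' => u v h1 h1' h2 h2' ha hb.
  by rewrite ler_norml; apply/andP; split; lra.
have mE : measurable ([set s | B (S s y)] : set (measurableTypeR R)).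
  exact: measurable_visits.
have mE' : measurable ([set s | B (S s y')] : set (measurableTypeR R)).
  exact: measurable_visits.
suff : [the measure (measurableTypeR R) R of mrestr lam mE] A =
  [the measure (measurableTypeR R) R of mrestr lam mE'] A by [].
apply: (@measure_unique _ R (measurableTypeR R) (@ocitv R) (fun n => `](- n%:R), n%:R]%classic)) => //.
- exact: ocitvI.
- by move=> i; exact: is_ocitv.
- apply/seteqP; split=> // x _; exists (Num.truncn `|x|).+1 => //=.
  rewrite in_itv /= ltrNl.
  have h1 := @truncnS_gt R `|x|; apply/andP; split.
    by apply: le_lt_trans h1; rewrite -normrN; exact: ler_norm.
  by apply/ltW; apply: le_lt_trans h1; exact: ler_norm.
- by move=> _ [[a b] _ <-] /=; rewrite /mrestr !occE// hr.
- by move=> k; rewrite /mrestr /=; exact: lam_oc_lty.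
Qed.

(** [occ_eq_visits], tested on the times when one orbit is in [B i] and the other is not, shows that
    these times are null. Some time [s] avoids all these countably many null sets; there the two
    orbits coincide, and flowing back by [s] gives [y = y']. *)
Lemma occ_separates (I : countType) (B : I -> set Y) y y' :
  (forall i, measurable (B i)) ->
  (forall x x', (forall i, B i x <-> B i x') -> x = x') ->
  (forall i (a b : rat), occ (B i) (ratr a) (ratr b) y = occ (B i) (ratr a) (ratr b) y') ->
  y = y'.
Proof.
move=> mB sep h.
have d0 i z z' : (forall a b : rat, occ (B i) (ratr a) (ratr b) z = occ (B i) (ratr a) (ratr b) z') ->
    lam.-negligible [set s | B i (S s z) /\ ~ B i (S s z')].
  move=> hz; have mD : measurable [set s | B i (S s z) /\ ~ B i (S s z')].
    apply: measurable_conj; first exact: measurable_visits.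
    by apply: measurableC; exact: measurable_visits.
  apply/negligibleP => //.
  have := occ_eq_visits (mB i) hz mD.
  rewrite (_ : _ `&` [set s | B i (S s z')] = set0) ?measure0; last first.
    by apply/seteqP; split=> s //= [[_ h1] h2].
  by move=> <-; congr (lam _); apply/seteqP; split=> s //=; [move=> [? ?]|move=> [[? ?] ?]].
have : lam.-negligible (\bigcup_n (if unpickle n is Some i then
    [set s | B i (S s y) /\ ~ B i (S s y')] `|` [set s | B i (S s y') /\ ~ B i (S s y)] else set0)).
  apply: negligible_bigcup => n; case: (unpickle n) => [i|]; last exact: negligible_set0.
  by apply: negligibleU; apply: d0 => // a b; rewrite h.
set N := \bigcup_n _ => -[A [mA A0 NA]].
have [s nNs] : exists s, ~ N s.
  apply: contrapT => hN; have : lam setT = 0%E.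
    rewrite (_ : setT = A)//; apply/seteqP; split=> // s _; apply: NA.
    by apply: contrapT => ns; apply: hN; exists s.
  apply/eqP; rewrite gt_eqF//; apply: (@lt_le_trans _ _ (lam `]0, 1]%classic)).
    by rewrite lam_oc subr0 max_r// lte_fin.
  by apply: le_measure; rewrite ?inE.
have Ss : S s y = S s y'.
  apply: sep => i; apply: contrapT => hi; apply: nNs; exists (pickle i) => //.
  rewrite pickleK; have [h1|h1] := pselect (B i (S s y)).
    by left; split=> // h2; apply: hi.
  by right; split=> //; apply: contrapT => h2; apply: hi.
by rewrite -(flowNK s y) Ss flowNK.
Qed.

End OccupationTime.

(** * Zero-one law and commuting maps that preserve orbits *)

Section ZeroOne.
Context (R : realType) dY (Y : measurableType dY).
Variables (nu : probability Y R) (S : R -> Y -> Y).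
Hypothesis flow : mp_flow nu S.
Hypothesis erg : flow_ergodic nu S.
Notation lam := (@lebesgue_measure R).

(* A set invariant up to null sets for each time agrees a.e. with the strictly
   invariant set of points whose orbit lies in it for almost every time. *)
Lemma ae_invariant_01 (A : set Y) : measurable A ->
  (forall s, {ae nu, forall y, A (S s y) <-> A y}) -> pr nu A = 0 \/ pr nu A = 1.
Proof.
move=> mA iA.
pose W := [set p : Y * R | ~ A (S p.2 p.1)].
have mW : measurable W by apply: measurableC; exact: (measurable_flow_joint flow mA).
pose A' := [set y | lam [set s | ~ A (S s y)] = 0%E].
have mA' : measurable A'.
  have -> : A' = (lam \o xsection W) @^-1` [set 0%E].
    by apply/seteqP; split=> y /=; rewrite xsection_setE.
  apply: measurable_preimT; last exact: emeasurable_set1.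
  exact: measurable_fun_xsection.
have mv y : measurable [set s | ~ A (S s y)].
  by apply: measurableC; exact: (measurable_visits flow y mA).
have iA' t : S t @^-1` A' = A'.
  have shift z : lam [set s | ~ A (S s (S t z))] = lam [set s | ~ A (S s z)].
    rewrite -[RHS](lebesgue_shift t)//; congr (lam _).
    by apply/seteqP; split=> s /=; rewrite (flowD flow).
  by apply/seteqP; split=> z; rewrite /A' /= shift.
pose D := [set p : Y * R | ~ (A (S p.2 p.1) <-> A p.1)].
have mA1 : measurable [set p : Y * R | A p.1].
  exact: (measurable_preimT (@measurable_fst _ _ Y R) mA).
have mD : measurable D.
  have -> : D = ([set p | A (S p.2 p.1)] `&` ~` [set p | A p.1]) `|`
      (W `&` [set p | A p.1]).
    apply/seteqP; split=> p; rewrite /D /W /=; last by tauto.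
    by have := EM (A p.1); have := EM (A (S p.2 p.1)); tauto.
  have mS := measurable_flow_joint flow mA.
  by apply: measurableU; apply: measurableI => //; exact: measurableC.
(* Fubini: the slice of [D] at each time is null by hypothesis, so for almost every [y] the set of
   bad times is null. *)
have D0 : {ae nu, forall y, lam [set s | ~ (A (S s y) <-> A y)] = 0%E}.
  have e12 : (nu \x lam)%E D = (nu \x^ lam)%E D.
    apply: (@product_measure_unique _ _ _ _ _ nu lam) => // B C mB mC.
    exact: product_measure2E.
  have z2 : (nu \x^ lam)%E D = 0%E.
    rewrite /product_measure2; apply: integral0_eq => s _ /=.
    have [N [mN N0 DN]] := iA s.
    apply/eqP; rewrite eq_le measure_ge0 andbT -N0.
    apply: le_measure; rewrite ?inE//; first exact: measurable_ysection.
    by move=> y; rewrite /ysection /= inE => h; apply: DN.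
  have := e12; rewrite z2 /product_measure1 => /eqP.
  move=> /eqP i0.
  have : ae_eq nu setT (lam \o xsection D) (cst 0%E).
    apply/ae_eq_integral_abs => //; first exact: measurable_fun_xsection.
    rewrite -[RHS]i0; apply: eq_integral => y _ /=; rewrite gee0_abs//.
  apply: filterS => y /(_ I) /=; rewrite xsection_setE//.
have AA' : {ae nu, forall y, A' y <-> A y}.
  apply: filterS D0 => y h; split.
    rewrite /A' /= => h0; apply: contrapT => nA.
    have : lam setT = 0%E.
      rewrite (_ : setT = [set s | ~ A (S s y)] `|` [set s | ~ (A (S s y) <-> A y)]); last first.
        by apply/seteqP; split=> // s _ /=; have [?|?] := pselect (A (S s y)); [right; tauto|left].
      apply/eqP; rewrite eq_le measure_ge0 andbT.
      have m2 : measurable [set s | ~ (A (S s y) <-> A y)].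
        by have := measurable_xsection y mD; rewrite xsection_setE.
      have s0 : (lam [set s | ~ A (S s y)] + lam [set s | ~ (A (S s y) <-> A y)] <= 0)%E.
        by rewrite h0 h adde0.
      exact: le_trans (measureU2 lam (mv y) m2) s0.
    apply/eqP; rewrite gt_eqF//; apply: (@lt_le_trans _ _ (lam `]0, 1]%classic)).
      by rewrite lam_oc subr0 max_r// lte_fin.
    by apply: le_measure; rewrite ?inE.
  move=> Ay; rewrite /A' /= -h; congr (lam _); apply/seteqP; split=> s /=; tauto.
rewrite -(eq_pr_ae mA' mA AA').
by case: (erg mA' iA') => h; [left|right]; rewrite /pr h.
Qed.

Variable I : countType.
Variable B : I -> set Y.
Hypothesis mB : forall i, measurable (B i).
Hypothesis sepB : forall x x', (forall i, B i x <-> B i x') -> x = x'.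

(** Index of the coordinates [F], which separate points and are 2-Lipschitz in time: they turn
    [V y = S t y] into countably many real equations, stable under small changes of [t]. *)
Let J := (I * rat * rat)%type.
Let F (j : J) : Y -> R := occ S (B j.1.1) (ratr j.1.2) (ratr j.2).

Let mF j : measurable_fun setT (F j).
Proof. exact: (measurable_occ flow). Qed.

Let F_lip j t t' y : `|F j (S t y) - F j (S t' y)| <= 2 * `|t - t'|.
Proof. exact: (occ_orbit_lip flow). Qed.

Let F_sep y y' : (forall j, F j y = F j y') -> y = y'.
Proof.
by move=> h; apply: (occ_separates flow mB sepB) => i a b; exact: (h (i, a, b)).
Qed.

Variable V : Y -> Y.
Hypothesis mV : measurable_fun setT V.

Let G (a b : R) := [set y | exists t, [/\ a <= t, t <= b & V y = S t y]].

Let inv_lt (e : R) : 0 < e -> exists n : nat, n.+1%:R^-1 < e.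
Proof.
by move=> e0; exists (Num.truncn e^-1); rewrite invf_plt ?posrE//; exact: truncnS_gt.
Qed.

Let le_inv (n m : nat) : (n <= m)%N -> m.+1%:R^-1 <= n.+1%:R^-1 :> R.
Proof. by move=> nm; rewrite lef_pV2 ?posrE// ler_nat. Qed.

(* Compactness of [a, b] turns the uncountable union over t into countable operations. *)
Lemma orbit_itvE a b : G a b = [set y | forall n : nat, exists q : rat,
  [/\ a - n.+1%:R^-1 <= ratr q, ratr q <= b + n.+1%:R^-1 &
    forall j : J, (pickle j <= n)%N -> `|F j (V y) - F j (S (ratr q) y)| < n.+1%:R^-1]].
Proof.
apply/seteqP; split=> y /=.
  move=> [t [at_ tb Vt]] n.
  have n0 : 0 < n.+1%:R^-1 :> R by rewrite invr_gt0.
  set e : R := n.+1%:R^-1 in n0 *.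
  (* Half of [1 / (n + 1)], because the coordinates are 2-Lipschitz. *)
  have [q] := @rat_in_itvoo R (t - e / 2) (t + e / 2) (ltac:(lra)).
  rewrite in_itv /= => q_itv; exists q.
  move: (ratr q : R) q_itv => r /andP[r1 r2]; split; [lra|lra|].
  move=> j _; rewrite Vt; apply: le_lt_trans (F_lip j t r y) _.
  have : `|t - r| < e / 2 by rewrite ltr_norml; apply/andP; split; lra.
  lra.
move=> h; have /choice[q qP] := h.
(* The times [ratr (q n)] need not converge; a cluster point of their tails in [[a - 1, b + 1]] is
   enough. *)
pose Fl : set_system R := filter_from setT (fun N => [set (ratr (q n) : R) | n in [set n | (N <= n)%N]]).
have FlP : ProperFilter Fl.
  apply: filter_from_proper; last by move=> N _; exists (ratr (q N)); exists N => /=.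
  apply: filter_from_filter; first by exists 0%N.
  move=> i k _ _; exists (maxn i k) => // _ [n /= n1 <-].
  by split; exists n => //=; apply: leq_trans n1; rewrite ?leq_maxl ?leq_maxr.
have [|t [/= tab clt]] := @segment_compact R (a - 1) (b + 1) Fl FlP.
  exists 0%N => // _ [n _ <-] /=; rewrite in_itv /=.
  have [h1 h2 _] := qP n.
  have n1 : n.+1%:R^-1 <= 1 :> R by rewrite invf_le1 ?ler1n.
  by move: (ratr (q n) : R) (n.+1%:R^-1 : R) h1 h2 n1 => r s ? ? ?; apply/andP; split; lra.
have close (e : R) N : 0 < e -> exists2 n, (N <= n)%N & `|ratr (q n) - t| < e.
  move=> e0; have [||r] := clt [set (ratr (q n) : R) | n in [set n | (N <= n)%N]] (ball t e).
  - by exists N.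
  - by apply/nbhs_ballP; exists e.
  move=> [[n /= Nn <-]]; rewrite /ball /= => h2; exists n => //.
  by rewrite distrC.
have {}close (e : R) N : 0 < e -> exists n, [/\ (N <= n)%N, n.+1%:R^-1 < e & `|ratr (q n) - t| < e].
  move=> e0; have [m mP] := inv_lt e0; have [n Nn nP] := close e (maxn m N) e0; exists n.
  split=> //; first by apply: leq_trans Nn; exact: leq_maxr.
  by apply: le_lt_trans mP; apply: le_inv; apply: leq_trans Nn; exact: leq_maxl.
exists t; split.
- rewrite leNgt; apply/negP => ta.
  have e0 : 0 < (a - t) / 2 by rewrite divr_gt0// subr_gt0.
  have [n [_]] := close _ 0%N e0; have [h1 _ _] := qP n.
  move: (n.+1%:R^-1 : R) (ratr (q n) : R) h1 => s r h1 h2; rewrite ltr_norml => /andP[h3 h4]; lra.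
- rewrite leNgt; apply/negP => ta.
  have e0 : 0 < (t - b) / 2 by rewrite divr_gt0// subr_gt0.
  have [n [_]] := close _ 0%N e0; have [_ h1 _] := qP n.
  move: (n.+1%:R^-1 : R) (ratr (q n) : R) h1 => s r h1 h2; rewrite ltr_norml => /andP[h3 h4]; lra.
apply: F_sep => j; apply/eqP; rewrite -subr_eq0 -normr_le0; apply/ler_addgt0Pr => e e0.
rewrite add0r; have e3 : 0 < e / 3 by rewrite divr_gt0.
have [n [jn ne tn]] := close _ (pickle j) e3; have [_ _ /(_ j jn) h1] := qP n.
have h2 := F_lip j (ratr (q n)) t y.
apply: le_trans (ler_distD (F j (S (ratr (q n)) y)) _ _) _.
move: (`|ratr (q n) - t|) (n.+1%:R^-1 : R) (`|F j (V y) - _|) (`|F j _ - F j (S t y)|) h1 h2 ne tn.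
by move=> *; lra.
Qed.

Lemma measurable_orbit_itv a b : measurable (G a b).
Proof.
rewrite orbit_itvE; apply: measurable_forall => n; apply: measurable_exists => q.
have e : [set x | [/\ a - n.+1%:R^-1 <= ratr q, ratr q <= b + n.+1%:R^-1 &
    forall j : J, (pickle j <= n)%N -> `|F j (V x) - F j (S (ratr q) x)| < n.+1%:R^-1]] =
  [set x | (a - n.+1%:R^-1 <= ratr q /\ ratr q <= b + n.+1%:R^-1) /\
   forall j : J, (pickle j <= n)%N -> `|F j (V x) - F j (S (ratr q) x)| < n.+1%:R^-1].
  by apply/seteqP; split=> x /=; [move=> [? ? ?]|move=> [[? ?] ?]].
rewrite e; apply: measurable_conjl; apply: measurable_forall => j; apply: measurable_impl.
apply: measurable_lt_fun; last exact: measurable_cst.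
apply: measurableT_comp => //; apply: measurable_funB.
  exact: (measurableT_comp (mF j) mV).
exact: (measurableT_comp (mF j) (measurable_flow flow (ratr q))).
Qed.

Hypothesis comm : forall t, {ae nu, forall y, V (S t y) = S t (V y)}.

(** Times add commutatively, so for almost every [y] the same [t] serves [y] and [S s y]. *)
Lemma orbit_itv_01 a b : pr nu (G a b) = 0 \/ pr nu (G a b) = 1.
Proof.
apply: ae_invariant_01; first exact: measurable_orbit_itv.
move=> s; apply: filterS (comm s) => y cy; split=> -[t [at_ tb Vt]]; exists t; split=> //.
  rewrite -(flowNK flow s (V y)) -cy Vt -!(flowD flow); congr (S _ _).
  by ring.
by rewrite cy Vt -!(flowD flow) addrC.
Qed.

(** By the zero-one law some [G (- n) n] has full measure. Around the infimum of the right ends that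
    keep full measure, every interval of radius [1 / (k + 1)] has full measure too. Intersecting
    over [k], with coordinates continuous in time, pins the time to this infimum. *)
Lemma flow_element (W : set Y) : measurable W -> 0 < pr nu W ->
  (forall y, W y -> exists t, V y = S t y) ->
  exists t, {ae nu, forall y, V y = S t y}.
Proof.
move=> mW W0 WG.
have mG := measurable_orbit_itv.
have [n Gn] : exists n : nat, pr nu (G (- n%:R) n%:R) = 1.
  have [|||n hn] := @pr_cup1 _ _ _ nu (fun n : nat => G (- n%:R) n%:R) W (pr nu W) mW _ _ _ W0.
  - by [].
  - move=> n y [t [h1 h2 h3]]; exists t; rewrite -natr1; split=> //; lra.
  - apply: aeW => y /WG[t Vt]; exists (Num.truncn `|t|).+1, t.
    have := @truncnS_gt R `|t|; rewrite ltr_norml => /andP[h1 h2].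
    by split=> //; exact: ltW.
  exists n; case: (orbit_itv_01 (- n%:R) n%:R) => // h0.
  by move: hn; rewrite h0 add0r ltxx.
pose A := [set c : R | pr nu (G (- n%:R) c) = 1].
have iA : has_inf A.
  split; first by exists n%:R.
  exists (- n%:R) => c Ac; rewrite leNgt; apply/negP => cn.
  move: Ac; rewrite /A /= (_ : G _ _ = set0).
    by rewrite /pr measure0 => /esym/eqP; rewrite oner_eq0.
  by apply/seteqP; split=> // y [t [h1 h2 _]]; lra.
exists (inf A).
have G1 (k : nat) : pr nu (G (inf A - k.+1%:R^-1) (inf A + k.+1%:R^-1)) = 1.
  have k0 : 0 < k.+1%:R^-1 :> R by rewrite invr_gt0.
  set e : R := k.+1%:R^-1 in k0 *.
  have [c Ac ce] := inf_adherent k0 iA.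
  have up : pr nu (G (- n%:R) (inf A + e)) = 1.
    apply/eqP; rewrite eq_le pr_le1//= -[leLHS]Ac; apply: le_pr => // y [t [h1 h2 h3]].
    by exists t; split=> //; apply: le_trans h2 (ltW ce).
  have lo : pr nu (G (- n%:R) (inf A - e)) = 0.
    case: (orbit_itv_01 (- n%:R) (inf A - e)) => // h.
    have : inf A <= inf A - e by apply: ge_inf => //; case: iA.
    by rewrite lerDl oppr_ge0 leNgt k0.
  case: (orbit_itv_01 (inf A - e) (inf A + e)) => // h.
  suff : pr nu (G (- n%:R) (inf A + e)) <= 0 by rewrite up ler10.
  rewrite -[leRHS]addr0 -[X in _ <= X + _]lo -[X in _ <= _ + X]h; apply: prUU => // y [t [h1 h2 h3]].
  have [ht|ht] := leP t (inf A - e); first by left; exists t.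
  by right; exists t; split=> //; exact: ltW.
have : {ae nu, forall y, forall k : nat, G (inf A - k.+1%:R^-1) (inf A + k.+1%:R^-1) y}.
  by apply/ae_foralln => k; exact: pr1_ae.
apply: filterS => y h; apply: F_sep => j.
apply/eqP; rewrite -subr_eq0 -normr_le0; apply/ler_addgt0Pr => e e0; rewrite add0r.
have e2 : 0 < e / 2 by rewrite divr_gt0.
have [k kP] := inv_lt e2.
have [t [h1 h2 ->]] := h k.
apply: le_trans (F_lip j t (inf A) y) _.
suff : `|t - inf A| <= e / 2 by move: (`|_|) => r; lra.
by move: (k.+1%:R^-1 : R) kP h1 h2 => r *; rewrite ler_norml; apply/andP; split; lra.
Qed.

End ZeroOne.

(** * Ratner's property and the centralizer *)

Lemma mem_In (T : eqType) (x : T) (s : seq T) : x \in s -> List.In x s.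
Proof.
by elim: s => //= a s IH; rewrite inE => /predU1P[->|/IH]; [left|right].
Qed.

Section RatnerCentralizer.
Context (R : realType) dY (Y : measurableType dY) (dist : Y -> Y -> R).
Variables (nu : probability Y R) (S : R -> Y -> Y).
Hypothesis Hmet : is_metric dist.
Hypothesis Hsc : dsigma_compact dist.
Hypothesis Hborel : @measurable dY Y = dborel dist.
Hypothesis flow : mp_flow nu S.
Hypothesis erg : flow_ergodic nu S.

Lemma probability_inhabited d (T : measurableType d) (P : probability T R) : exists x : T, True.
Proof.
apply: contrapT => h; have := @probability_setT _ _ _ P.
rewrite (_ : setT = set0) ?measure0; first by move/eqP; rewrite eq_sym onee_eq0.
by apply/seteqP; split=> // x _; apply: h; exists x.
Qed.

Lemma prI_ge d (T : measurableType d) (P : probability T R) (A B : set T) (a b : R) :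
  measurable A -> measurable B -> a <= pr P A -> b <= pr P B ->
  a + b - 1 <= pr P (A `&` B).
Proof.
move=> mA mB aA bB; have mAB : measurable (A `&` B) by exact: measurableI.
have := prU P (measurableC mA) (measurableC mB).
rewrite -setCI !prC//; lra.
Qed.

Lemma iter_flow t n y : iter n (S t) y = S (n%:R * t) y.
Proof.
elim: n => [|n IH] /=; first by rewrite mul0r (flow0 flow).
by rewrite IH -(flowD flow) -natr1 mulrDl mul1r addrC.
Qed.

Lemma seq_min_gt0 (s : seq R) (f : R -> R) : (forall p, p \in s -> 0 < f p) ->
  exists n : nat, forall p, p \in s -> n.+1%:R^-1 <= f p.
Proof.
elim: s => [|p s IH] h; first by exists 0%N.
have [|n nP] := IH; first by move=> q qs; apply: h; rewrite inE qs orbT.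
have p0 : 0 < f p by apply: h; rewrite inE eqxx.
exists (maxn n (Num.truncn (f p)^-1)) => q; rewrite inE => /predU1P[->|/nP h'].
  apply: (@le_trans _ _ ((Num.truncn (f p)^-1).+1%:R^-1)).
    by rewrite lef_pV2 ?posrE// ler_nat ltnS leq_maxr.
  by rewrite invf_ple ?posrE//; apply/ltW; exact: truncnS_gt.
by apply: le_trans h'; rewrite lef_pV2 ?posrE// ler_nat ltnS leq_maxl.
Qed.

Variables (t0 : R) (P : seq R).
Hypothesis ratner : R_property dist nu S t0 P.
Hypothesis freeP : forall p, p \in P -> {ae nu, forall y, S p y <> y}.

Let dense : exists u : nat -> Y, forall x (e : R), 0 < e -> exists n, dist x (u n) < e.
Proof.
by have [y0 _] := probability_inhabited nu; exact: (sigma_compact_separable Hmet Hsc y0).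
Qed.

Let mdist_lt (f g : Y -> Y) (r : R) : measurable_fun setT f -> measurable_fun setT g ->
  measurable [set z | dist (f z) (g z) < r].
Proof. by have [u uP] := dense; exact: (measurable_dist_lt Hmet Hborel uP). Qed.

Let mdist_ge (f g : Y -> Y) (r : R) : measurable_fun setT f -> measurable_fun setT g ->
  measurable [set z | r <= dist (f z) (g z)].
Proof. by have [u uP] := dense; exact: (measurable_dist_ge Hmet Hborel uP). Qed.

(** [P] is addressed by positions because [measurable_exists] needs a countable index type. *)
Let returns (e : R) : set Y :=
  [set z | exists i : nat, (i < size P)%N /\ dist z (S (nth 0 P i) z) < e].

Let measurable_returns e : measurable (returns e).
Proof.
apply: measurable_exists => i; apply: measurable_conjl; apply: mdist_lt => //.
exact: (measurable_flow flow).
Qed.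

(** At almost every [y] the finitely many distances [dist y (S p y)] have a positive minimum;
    continuity from above makes one [e] serve most points. *)
Let returns_small (c : R) : 0 < c -> exists e : R, [/\ 0 < e, e <= 1 & pr nu (returns e) < c].
Proof.
move=> c0.
have [|||n nc] := @pr_cap0 _ _ _ nu (fun n => returns n.+1%:R^-1) c _ _ _ c0.
- by move=> n; exact: measurable_returns.
- move=> n z [i [iP h]]; exists i; split=> //; apply: lt_le_trans h _.
  by rewrite lef_pV2 ?posrE// ler_nat.
- have : {ae nu, forall y, forall i : nat, (i < size P)%N -> S (nth 0 P i) y <> y}.
    apply/ae_foralln => i; have [iP|iP] := boolP (i < size P)%N; last first.
      exact: aeW.
    by apply: filterS (freeP (mem_nth 0 iP)).
  apply: filterS => y hy.
  have [|n nP] := @seq_min_gt0 P (fun p => dist y (S p y)).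
    move=> p /(nthP 0)[i iP <-]; apply: dist_gt0 => // /esym; exact: hy.
  exists n => -[i [iP]]; have := nP _ (mem_nth 0 iP); rewrite ltNge => -> //.
exists n.+1%:R^-1; split=> //.
by rewrite invf_le1// ler1n.
Qed.

(** Displacement is tested at [S p z] and not at [z]: Ratner's property compares [z] with
    [S p (V z)], which is [V (S p z)]. *)
Let moves (V : Y -> Y) (e : R) : set Y :=
  [set z | exists i : nat, (i < size P)%N /\
     e <= dist (V (S (nth 0 P i) z)) (S (nth 0 P i) z)].

Let measurable_moves V e : measurable_fun setT V -> measurable (moves V e).
Proof.
move=> mV; apply: measurable_exists => i; apply: measurable_conjl; apply: mdist_ge.
  exact: (measurableT_comp mV (measurable_flow flow _)).
exact: (measurable_flow flow).
Qed.

Let pr_moves V e c : measurable_fun setT V ->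
  pr nu [set z | e <= dist (V z) z] <= c -> pr nu (moves V e) <= c *+ size P.
Proof.
move=> mV hc; rewrite -(size_iota 0 (size P)).
apply: (@pr_bigU _ _ _ nu nat _ _ (fun i => S (nth 0 P i) @^-1` [set z | e <= dist (V z) z])).
- exact: measurable_moves.
- by move=> i; apply: measurable_preimT; [exact: (measurable_flow flow) | exact: mdist_ge].
- by move=> i; rewrite (pr_flow flow)//; exact: mdist_ge.
move=> z [i [iP h]]; exists i => //.
by apply: mem_In; rewrite mem_iota.
Qed.

(** Measure budget: [Q] misses at most 1/5, [Z] and its preimage at most 1/8 each, [K] and the
    complement of [X] at most 1/10 each, so [W] has positive measure. Counting: if [y] in [W] had
    [V y] off its orbit, more than [7 / 8 * L] times of the window would be good, while each good
    time falls in [returns] or in [moves], which account for at most [L / 4] each. *)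
Lemma ratner_centralizer : exists2 delta : R, 0 < delta & exists2 eta : R, 0 < eta &
  forall V : Y -> Y, measure_preserving nu V ->
    (forall t, {ae nu, forall y, V (S t y) = S t (V y)}) ->
    pr nu [set y | delta <= dist (V y) y] < eta ->
    exists t, {ae nu, forall y, V y = S t y}.
Proof.
have mpS t : measure_preserving nu (S t) by case: flow.
(* [8 / 80 = 1 / 10] is the loss charged by [birk_window]; below, [e = r / 8] is at most 1/8 and
   leaves [2 * e < r] for the triangle inequality. *)
have [r [r0 r1 rsmall]] := @returns_small (80^-1) (ltac:(by rewrite invr_gt0)).
pose e : R := r / 8; have e0 : 0 < e by rewrite divr_gt0.
have [kappa k0 ratk] := ratner e0.
have [N0 [Q [mQ prQ windowQ]]] := birk_window (mpS t0) (measurable_returns r) k0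
   (e := 10^-1) (ltac:(by rewrite invr_gt0)).
have [d0 d0gt [Z [mZ prZ ratZ]]] := ratk (maxn N0 2).
(* With [M <= L / kappa] and [1 <= L] this gives [lam * (M + L + 1) <= L / 4]. *)
pose lam : R := (4 * (kappa^-1 + 2))^-1.
have ki : 0 < kappa^-1 by rewrite invr_gt0.
have lam0 : 0 < lam by rewrite invr_gt0 mulr_gt0// addr_gt0.
(* The second bound, summed over the elements of [P], gives [pr nu D <= lam / 10], and the maximal
   inequality then gives [pr nu X <= 1 / 10]. *)
pose eta : R := Num.min (10^-1) (lam / (10 * (size P).+1%:R)).
have eta0 : 0 < eta by rewrite lt_min invr_gt0 ltr0n /= divr_gt0// mulr_gt0.
exists (Num.min d0 e); first by rewrite lt_min d0gt.
exists eta => // V mpV comm Vclose.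
have mV := mpV.1.
set D := moves V e; have mD : measurable D by exact: measurable_moves.
have prD : pr nu D <= lam / 10.
  have Ve : pr nu [set z | e <= dist (V z) z] <= eta.
    apply/ltW; apply: le_lt_trans Vclose; apply: le_pr; [exact: mdist_ge|exact: mdist_ge|].
    by move=> z /= h; rewrite ge_min h orbT.
  apply: le_trans (pr_moves mV Ve) _; rewrite -[leLHS]mulr_natr.
  apply: (@le_trans _ _ (lam / (10 * (size P).+1%:R) * (size P).+1%:R)).
    by apply: ler_pM => //; [exact: ltW|rewrite ge_min lexx orbT|rewrite ler_nat].
  by rewrite invfM mulrA divfK// pnatr_eq0.
have bD := bmf_indic R mD.
pose X := [set x | exists k, lam * k%:R < birk (S t0) \1_D k x].
have mX : measurable X.
  apply: measurable_exists => k; apply: measurable_lt_fun; first exact: measurable_cst.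
  by apply: (measurable_birk (mpS t0)); case: bD.
have prX : pr nu X <= 10^-1.
  have := maximal_inequality (mpS t0) bD (c := lam).
  rewrite Rintegral_indicT// => h.
  have {}h : lam * pr nu X <= pr nu D by apply: h; [move=> x; rewrite indicE|exact: ltW].
  by rewrite -(ler_pM2l lam0); exact: le_trans h prD.
(* Commutation fails on a null set depending on the time; only countably many times occur in the
   windows. *)
have [A [mA A0 commA]] : {ae nu, forall y, forall n i : nat,
    V (S (n%:R * t0 + nth 0 P i) y) = S (n%:R * t0 + nth 0 P i) (V y)}.
  by apply/ae_foralln => n; apply/ae_foralln => i; exact: comm.
have mVZ : measurable (V @^-1` Z) by exact: measurable_preimT.
have prZ' : 1 - e < pr nu Z by rewrite -lte_fin -prE.
have e8 : e <= 8^-1 by rewrite /e; lra.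
pose K := [set y | dist (V y) y < Num.min d0 e].
have mK : measurable K by exact: mdist_lt.
have prK : 9 / 10 <= pr nu K.
  have -> : K = ~` [set y | Num.min d0 e <= dist (V y) y].
    by apply/seteqP; split=> y; rewrite /K /= ltNge => /negP.
  rewrite prC; last exact: mdist_ge.
  have : eta <= 10^-1 by rewrite ge_min lexx.
  lra.
pose W := Q `&` (Z `&` (V @^-1` Z `&` (K `&` (~` X `&` ~` A)))).
have mC (B : set Y) : measurable B -> measurable (~` B) := @measurableC _ _ B.
have mI (B C : set Y) : measurable B -> measurable C -> measurable (B `&` C) := @measurableI _ _ B C.
have mW : measurable W.
  exact: (mI _ _ mQ (mI _ _ mZ (mI _ _ mVZ (mI _ _ mK (mI _ _ (mC _ mX) (mC _ mA)))))).
have W0 : 0 < pr nu W.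
  have pA : pr nu (~` A) = 1 by rewrite prC// /pr A0 /= subr0.
  have pX : 9 / 10 <= pr nu (~` X) by rewrite prC//; lra.
  have pVZ : pr nu (V @^-1` Z) = pr nu Z by rewrite (pr_preim mpV).
  have h1 := prI_ge (mC _ mX) (mC _ mA) pX (lexx _); rewrite pA in h1.
  have h2 := prI_ge mK (mI _ _ (mC _ mX) (mC _ mA)) prK h1.
  have h3 := prI_ge mVZ (mI _ _ mK (mI _ _ (mC _ mX) (mC _ mA))) (lexx _) h2.
  have h4 := prI_ge mZ (mI _ _ mVZ (mI _ _ mK (mI _ _ (mC _ mX) (mC _ mA)))) (lexx _) h3.
  have := prI_ge mQ (mI _ _ mZ (mI _ _ mVZ (mI _ _ mK (mI _ _ (mC _ mX) (mC _ mA)))))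
    (lexx _) h4.
  rewrite -/W pVZ; lra.
have [u uP] := dense.
apply: (flow_element flow erg (B := ratball dist u) _ _ mV comm mW W0).
- by move=> i; exact: measurable_ratball.
- by move=> x x'; exact: (ratball_separates Hmet uP).
move=> y [Qy [Zy [ZVy [Ky [nX nA]]]]]; apply: contrapT => notorbit.
have commy : forall n i : nat,
    V (S (n%:R * t0 + nth 0 P i) y) = S (n%:R * t0 + nth 0 P i) (V y).
  by apply: contrapT => h; apply: nA; apply: commA.
have [| |M [L [NM NL kLM [p pP]]]] := ratZ y (V y) Zy ZVy.
- by move=> [t yt]; apply: notorbit; exists (- t); rewrite {2}yt (flowNK flow).
- case: Hmet => _ _ -> _; apply: lt_le_trans Ky _; by rewrite ge_min lexx.
have /(nthP 0)[i iP ip] := pP.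
move: NM NL; rewrite !geq_max => /andP[NM M2] /andP[NL L2].
have L0 : 0 < L%:R :> R by rewrite ltr0n; exact: leq_trans L2.
have M0 : 0 < M%:R :> R by rewrite ltr0n; exact: leq_trans M2.
rewrite ltr_pdivlMr//.
set c := fun n : nat => dist (S (n%:R * t0) y) (S (n%:R * t0 + p) (V y)) < e.
pose cB n := `[< returns r (iter n (S t0) y) >].
pose cD n := `[< D (iter n (S t0) y) >].
(* A good time with small displacement is a near-return, by the triangle inequality through
   [V (S p z)]. *)
have csub : (count c (iota M L.+1) <= count cB (iota M L.+1) + count cD (iota M L.+1))%N.
  rewrite -count_predUI; apply: leq_trans (leq_addr _ _).
  apply: sub_count => n; rewrite /c /cB /cD /= -ip -commy iter_flow addrC (flowD flow).
  set z := S _ y => h; apply/orP.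
  have [h1|h1] := leP e (dist (V (S (nth 0 P i) z)) (S (nth 0 P i) z)).
    by right; apply/asboolP; exists i.
  left; apply/asboolP; exists i; split=> //.
  case: Hmet => _ _ _ tri; apply: le_lt_trans (tri _ (V (S (nth 0 P i) z)) _) _.
  by rewrite /e in h h1; lra.
have hB : (count cB (iota M L.+1))%:R <= L%:R / 4 :> R.
  apply: le_trans (windowQ y Qy M L NM NL kLM).
  by apply: count_birk => n /asboolP.
have hD : (count cD (iota M L.+1))%:R <= L%:R / 4 :> R.
  apply: (@le_trans _ _ (birk (S t0) \1_D (M + L.+1) y - birk (S t0) \1_D M y)).
    by apply: count_birk => n /asboolP.
  apply: (@le_trans _ _ (lam * (M + L.+1)%:R)).
    rewrite lerBlDr; apply: (@le_trans _ _ (lam * (M + L.+1)%:R + 0)).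
      by rewrite addr0 leNgt; apply/negP => h; apply: nX; exists (M + L.+1)%N.
    by rewrite lerD2l; apply: sumr_ge0 => j _; rewrite indicE.
  rewrite natrD -(natr1 L).
  have ML : M%:R <= L%:R * kappa^-1 :> R by rewrite ler_pdivlMr// mulrC -ler_pdivlMr.
  have L1 : 1 <= L%:R :> R by rewrite ler1n; exact: leq_trans L2.
  apply: (@le_trans _ _ (lam * (L%:R * kappa^-1 + 2 * L%:R))).
    by rewrite ler_pM2l//; lra.
  have -> : L%:R * kappa^-1 + 2 * L%:R = (4 * (kappa^-1 + 2)) * (L%:R / 4) by field; rewrite gt_eqF.
  by rewrite [leLHS]mulrA; rewrite /lam mulVf ?mul1r// gt_eqF// mulr_gt0// addr_gt0.
have : (count c (iota M L.+1))%:R <= (count cB (iota M L.+1))%:R + (count cD (iota M L.+1))%:R :> R.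
  by rewrite -natrD ler_nat.
have eL : e * L%:R <= 8^-1 * L%:R by rewrite ler_pM2r.
move: hB hD; set b1 : R := (count c _)%:R; set b2 : R := (count cB _)%:R.
set b3 : R := (count cD _)%:R => hB hD h; rewrite mulrBl mul1r.
by move: (e * _) eL => q eL; lra.
Qed.

End RatnerCentralizer.

(** * Transfer from the metric model *)

Section AlmostEverywhere.
Context (R : realType) d1 d2 (X : measurableType d1) (Y : measurableType d2).
Variables (mu : probability X R) (nu : probability Y R) (h : X -> Y).
Hypothesis mh : measurable_fun setT h.
Hypothesis hP : forall B, measurable B -> mu (h @^-1` B) = nu B.

Lemma ae_preim (Q : Y -> Prop) : {ae nu, forall y, Q y} -> {ae mu, forall x, Q (h x)}.
Proof.
move=> [A [mA A0 QA]]; exists (h @^-1` A); split.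
- exact: measurable_preimT.
- by rewrite hP.
by move=> x /= nQ; apply: QA.
Qed.

Lemma pr_pushforward (B : set Y) : measurable B -> pr mu (h @^-1` B) = pr nu B.
Proof. by move=> mB; rewrite /pr hP. Qed.

End AlmostEverywhere.

Section Transfer.
Context (R : realType) dX (X : measurableType dX) dY (Y : measurableType dY).
Variables (mu : probability X R) (T : R -> X -> X).
Variables (dist : Y -> Y -> R) (nu : probability Y R) (S : R -> Y -> Y).
Hypothesis flowT : mp_flow mu T.
Hypothesis freeT : flow_free mu T.
Hypothesis Hmet : is_metric dist.
Hypothesis Hsc : dsigma_compact dist.
Hypothesis Hborel : @measurable dY Y = dborel dist.
Hypothesis flowS : mp_flow nu S.
Hypothesis ergS : flow_ergodic nu S.
Hypothesis ratner : metric_ratner dist nu S.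
Variables (phi : X -> Y) (psi : Y -> X).
Hypothesis mphi : measurable_fun setT phi.
Hypothesis mpsi : measurable_fun setT psi.
Hypothesis phiP : forall B, measurable B -> mu (phi @^-1` B) = nu B.
Hypothesis psiP : forall A, measurable A -> nu (psi @^-1` A) = mu A.
Hypothesis phiK : {ae mu, forall x, psi (phi x) = x}.
Hypothesis psiK : {ae nu, forall y, phi (psi y) = y}.
Hypothesis phiT : forall t, {ae mu, forall x, phi (T t x) = S t (phi x)}.

Let aephi := ae_preim mphi phiP.
Let aepsi := ae_preim mpsi psiP.
Let aemp (h : X -> X) (mp : measure_preserving mu h) := ae_preim mp.1 mp.2.
Let mpT t : measure_preserving mu (T t). Proof. by case: flowT. Qed.
Let mpS t : measure_preserving nu (S t). Proof. by case: flowS. Qed.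

Lemma psi_flow t : {ae nu, forall y, psi (S t y) = T t (psi y)}.
Proof.
have h1 := aepsi (phiT t).
have h2 := aepsi (aemp (mpT t) phiK).
by apply: filterS3 psiK h1 h2 => y e1 e2 e3; rewrite -{1}e1 -e2 e3.
Qed.

(** The isomorphism respects each time off its own null set, so freeness reaches the model one time
    at a time; this suffices for the finite set [P]. *)
Lemma free_model t : t != 0 -> {ae nu, forall y, S t y <> y}.
Proof.
move=> t0; have h1 := aepsi freeT.
apply: filterS2 h1 (psi_flow t) => y f e Sy.
by apply: (f t t0); rewrite -e Sy.
Qed.

(** [ratner_centralizer] is applied to the transport [V] of [S2] composed with the inverse of [S1].
    Since [S1] preserves [mu], the displacement of [V] is distributed like the distance between
    [phi (S1 x)] and [phi (S2 x)]. *)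
Lemma close_ess_equiv : exists2 delta : R, 0 < delta & exists2 eta : R, 0 < eta &
  forall S1 S2, centralizer mu T S1 -> centralizer mu T S2 ->
    pr mu [set x | delta <= dist (phi (S2 x)) (phi (S1 x))] < eta ->
    ess_equiv mu T S2 S1.
Proof.
have [P [P0 unc]] := ratner.
have [s [_ Rs]] : exists s, s != 0 /\ R_property dist nu S s P.
  apply: contrapT => h; apply: unc.
  rewrite (_ : [set s | _] = set0); first exact: countable0.
  by apply/seteqP; split=> // s hs; apply: h; exists s.
have freeP p : p \in P -> {ae nu, forall y, S p y <> y}.
  by move=> pP; apply: free_model; apply: contraNneq P0 => <-.
have [delta d0 [eta e0 core]] := ratner_centralizer Hmet Hsc Hborel flowS ergS Rs freeP.
have [y0 _] := probability_inhabited nu.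
have [u uP] := sigma_compact_separable Hmet Hsc y0.
exists delta => //; exists eta => // S1 S2.
move=> [[mpS1 [S1' [mpS1' S1K S1'K]]] comm1] [[mpS2 _] comm2] close.
have comm1' t : {ae mu, forall x, S1' (T t x) = T t (S1' x)}.
  have h1 := aemp mpS1' (comm1 t).
  have h2 := aemp mpS1' (aemp (mpT t) S1K).
  by apply: filterS3 S1'K h1 h2 => x e1 e2 e3; rewrite -{1}e1 -e2 e3.
pose V y := phi (S2 (S1' (psi y))).
have mV : measurable_fun setT V.
  apply: (measurableT_comp mphi); apply: (measurableT_comp mpS2.1).
  exact: (measurableT_comp mpS1'.1 mpsi).
have mpV : measure_preserving nu V.
  split=> // B mB.
  have m1 := measurable_preimT mphi mB.
  have m2 := measurable_preimT mpS2.1 m1.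
  have m3 := measurable_preimT mpS1'.1 m2.
  by rewrite -[RHS]phiP// -(mpS2.2 _ m1) -(mpS1'.2 _ m2) -(psiP m3).
have commV t : {ae nu, forall y, V (S t y) = S t (V y)}.
  have h1 := psi_flow t.
  have h2 := aepsi (comm1' t).
  have h3 := aepsi (aemp mpS1' (comm2 t)).
  have h4 := aepsi (aemp mpS1' (aemp mpS2 (phiT t))).
  apply: filterS2 (filterI h1 h2) (filterI h3 h4) => y [e1 e2] [e3 e4].
  by rewrite /V e1 e2 e3 e4.
have mD : measurable [set x | delta <= dist (phi (S2 x)) (phi (S1 x))].
  apply: (measurable_dist_ge Hmet Hborel uP); apply: (measurableT_comp mphi).
    exact: mpS2.1.
  exact: mpS1.1.
have closeV : pr nu [set y | delta <= dist (V y) y] < eta.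
  apply: le_lt_trans close.
  rewrite -(pr_preim mpS1' mD) -(pr_pushforward psiP); last exact: (measurable_preimT mpS1'.1).
  apply: le_pr_ae.
  - exact: (measurable_dist_ge Hmet Hborel uP).
  - by apply: (measurable_preimT mpsi); exact: (measurable_preimT mpS1'.1).
  by apply: filterS2 psiK (aepsi S1'K) => y e1 e2 /=; rewrite e2 e1.
have [t Vt] := core V mpV commV closeV.
exists t.
have h1 := aemp mpS1 (aephi Vt).
have h2 := aemp mpS1 phiK.
have h3 := aemp mpS2 phiK.
have h4 := aemp (mpT t) (aemp mpS1 phiK).
have h5 := aemp mpS1 (phiT t).
apply: filterS2 (filterI (filterI h1 h2) (filterI h3 h4)) (filterI (filterI h5 S1K) (comm1 t)).
move=> x [[e1 e2] [e3 e4]] [[e5 e6] e7].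
by rewrite -e3 -[RHS]e4 e7 e5 -e1 /V e2 e6.
Qed.

(** Distances are traded for finitely many sets, the form that suits both the strong operator
    topology and approximation by a countable algebra. Balls of radius [delta / 2] cover most of the
    mass, and two points of one such ball are [delta]-close. *)
Lemma close_ess_equiv_sets : exists n : nat, exists2 C : nat -> set Y,
  (forall i, measurable (C i)) & exists2 eta : R, 0 < eta &
  forall S1 S2, centralizer mu T S1 -> centralizer mu T S2 ->
    (forall i, (i < n)%N ->
       pr mu [set x | ~ (C i (phi (S1 x)) <-> C i (phi (S2 x)))] < eta) ->
    ess_equiv mu T S2 S1.
Proof.
have [delta d0 [eta e0 core]] := close_ess_equiv.
have [y0 _] := probability_inhabited nu.
have [u uP] := sigma_compact_separable Hmet Hsc y0.
have tri : forall x y z, dist x z <= dist x y + dist y z by case: Hmet.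
have sym : forall x y, dist x y = dist y x by case: Hmet.
pose C i := [set y | dist (u i) y < delta / 2].
have mC i : measurable (C i) by exact: measurable_dball.
pose U n := [set y | exists i : nat, (i < n)%N /\ C i y].
have mU n : measurable (U n).
  by apply: measurable_exists => i; apply: measurable_conjl; exact: mC.
have e2 : 0 < eta / 2 by rewrite divr_gt0.
have [||n nP] := @pr_cup1 _ _ _ nu U setT (eta / 2) measurableT mU _ _ e2.
- by move=> n y [i [ni Ci]]; exists i; split=> //; exact: ltnW.
- apply: aeW => y _; have d2 : 0 < delta / 2 by rewrite divr_gt0.
  by have [k kP] := uP y _ d2; exists k.+1, k; split; rewrite // /C /= sym.
(* One half of [eta] pays for the uncovered part, the other for the [n] symmetric differences;
   [n.+1] also covers [n = 0]. *)
exists n, C => //; exists (eta / 2 / n.+1%:R); first by rewrite divr_gt0.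
move=> S1 S2 C1 C2 close; apply: core => //.
have mS1 := C1.1.1.1; have mS2 := C2.1.1.1.
have mp1 := measurableT_comp mphi mS1; have mp2 := measurableT_comp mphi mS2.
have mD i : measurable [set x | ~ (C i (phi (S1 x)) <-> C i (phi (S2 x)))].
  have -> : [set x | ~ (C i (phi (S1 x)) <-> C i (phi (S2 x)))] =
    [set x | C i (phi (S1 x)) /\ ~ C i (phi (S2 x))] `|`
    [set x | C i (phi (S2 x)) /\ ~ C i (phi (S1 x))].
    apply/seteqP; split=> x /=; last by tauto.
    by have := EM (C i (phi (S1 x))); have := EM (C i (phi (S2 x))); tauto.
  have m1 := measurable_preimT mp1 (mC i); have m2 := measurable_preimT mp2 (mC i).
  by apply: measurableU; apply: measurable_conj => //; exact: measurableC.
have mUS : measurable ((phi \o S1) @^-1` U n) by exact: measurable_preimT.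
pose B (i : nat) := if (i < n)%N then [set x | ~ (C i (phi (S1 x)) <-> C i (phi (S2 x)))] else set0.
have mB i : measurable (B i) by rewrite /B; case: ifP.
have hB i : pr mu (B i) <= eta / 2 / n.+1%:R.
  rewrite /B; case: ifP => [/close/ltW//|_].
  by rewrite /pr measure0 ltW// divr_gt0.
pose E := [set x | exists i, B i x].
have mE : measurable E by exact: measurable_exists.
have prE : pr mu E <= eta / 2.
  apply: (@le_trans _ _ (eta / 2 / n.+1%:R *+ size (iota 0 n))).
    apply: (pr_bigU mE mB hB) => x [i]; rewrite {1}/B; case: ifP => // ni Bi; exists i.
      by apply: mem_In; rewrite mem_iota.
    by rewrite /B ni.
  rewrite size_iota -mulr_natr -mulrA ger_pMr// mulrC ler_pdivrMr// mul1r ler_nat//.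
have prU : pr mu (~` ((phi \o S1) @^-1` U n)) < eta / 2.
  rewrite prC// -[_ @^-1` _]/(S1 @^-1` (phi @^-1` U n)).
  rewrite (pr_preim C1.1.1); last exact: (measurable_preimT mphi).
  by rewrite (pr_pushforward phiP)//; move: nP; rewrite prT; lra.
apply: le_lt_trans (_ : _ <= pr mu (~` ((phi \o S1) @^-1` U n)) + pr mu E) _; last by lra.
apply: prUU => //; first exact: (measurable_dist_ge Hmet Hborel uP).
  exact: measurableC.
move=> x /= far; have [[i [ni Ci]]|nU] := pselect (U n (phi (S1 x))); last by left.
right; exists i; rewrite /B ni /= => Cii.
have := Cii.1 Ci; move: Ci; rewrite /C /= => c1 c2.
have := tri (phi (S2 x)) (u i) (phi (S1 x)); rewrite (sym (phi (S2 x)) (u i)); lra.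
Qed.

Lemma EC_discrete_of_model : EC_discrete mu T.
Proof.
have [n [C mC [eta e0 core]]] := close_ess_equiv_sets.
move=> S1 C1.
have mphiC i : measurable (phi @^-1` C i) by exact: measurable_preimT.
exists [seq (\1_(phi @^-1` C i) : X -> R) | i <- iota 0 n]; exists eta => //; split.
  move=> f; elim: (iota _ _) => //= i s IH [<-|/IH//].
  split; first exact: measurable_indic.
  apply: (@le_lt_trans _ _ (\int[mu]_x (cst 1%E x))%E).
    apply: ge0_le_integral => //.
    - apply/measurable_EFinP; apply: measurable_funX; exact: measurable_indic.
    - by move=> x _; rewrite lee_fin indicE; case: (_ \in _); rewrite ?expr1n ?expr0n.
  by rewrite integral_cst// mul1e; apply: le_lt_trans (probability_le1 _ _) _; rewrite ?ltry.
move=> S2 C2 near; split=> //; apply: core => // i ni.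
have mS1 := C1.1.1.1; have mS2 := C2.1.1.1.
set D := [set x | _].
have inS : List.In (\1_(phi @^-1` C i) : X -> R) [seq (\1_(phi @^-1` C i) : X -> R) | i <- iota 0 n].
  by apply: (@List.in_map _ _ (fun i => \1_(phi @^-1` C i))); apply: mem_In; rewrite mem_iota.
have := near _ inS.
have m1 := measurable_preimT mS1 (mphiC i); have m2 := measurable_preimT mS2 (mphiC i).
have mD : measurable D.
  have -> : D = (S1 @^-1` (phi @^-1` C i) `\` S2 @^-1` (phi @^-1` C i)) `|`
    (S2 @^-1` (phi @^-1` C i) `\` S1 @^-1` (phi @^-1` C i)).
    apply/seteqP; split=> x; rewrite /D /setD /=; last by tauto.
    by have := EM (C i (phi (S1 x))); have := EM (C i (phi (S2 x))); tauto.
  by apply: measurableU; exact: measurableD.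
have -> : (\int[mu]_x (((\1_(phi @^-1` C i) : X -> R) (S2 x) -
    \1_(phi @^-1` C i) (S1 x)) ^+ 2)%:E = \int[mu]_x (\1_D x)%:E)%E.
  apply: eq_integral => x _; congr (_%:E); rewrite !indicE.
  have Dx : D x <-> ~ (S1 x \in phi @^-1` C i <-> S2 x \in phi @^-1` C i).
    by rewrite !inE.
  case: (boolP (S1 x \in _)) Dx => h1; case: (boolP (S2 x \in _)) => h2 Dx.
  - by rewrite memNset ?subrr ?expr0n// => /Dx; apply.
  - by rewrite mem_set ?sub0r ?sqrrN ?expr1n//; apply/Dx => -[/(_ isT)].
  - by rewrite mem_set ?subr0 ?expr1n//; apply/Dx => -[_ /(_ isT)].
  - by rewrite memNset ?subrr ?expr0n// => /Dx; apply.
by rewrite integral_indic// setIT -lte_fin -prE.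
Qed.

End Transfer.

(** * Separability of the measure algebra *)

Section DenseAlgebra.

(* Boolean combinations of basic balls: a countable algebra. *)
Inductive setform := Atom of (nat * nat) | Neg of setform | Or of setform & setform.

Fixpoint setform_tree (f : setform) : GenTree.tree (nat * nat) :=
  match f with
  | Atom i => GenTree.Leaf i
  | Neg g => GenTree.Node 0 [:: setform_tree g]
  | Or g h => GenTree.Node 1 [:: setform_tree g; setform_tree h]
  end.

Lemma setform_tree_inj : injective setform_tree.
Proof.
elim=> [i|f IH|f IHf g IHg] [j|f'|f' g'] //=; first by case=> ->.
  by case=> /IH ->.
by case=> /IHf -> /IHg ->.
Qed.

Definition setform_code (f : setform) : nat := pickle (setform_tree f).

Lemma setform_code_inj : injective setform_code.
Proof. by move=> f g /(pcan_inj pickleK)/setform_tree_inj. Qed.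

Context (R : realType) dY (Y : measurableType dY) (dist : Y -> Y -> R).
Variable nu : probability Y R.
Hypothesis Hmet : is_metric dist.
Hypothesis Hborel : @measurable dY Y = dborel dist.
Variable u : nat -> Y.
Hypothesis udense : forall x (e : R), 0 < e -> exists n, dist x (u n) < e.

Fixpoint interp (f : setform) : set Y :=
  match f with
  | Atom i => ratball dist u i
  | Neg g => ~` interp g
  | Or g h => interp g `|` interp h
  end.

Lemma measurable_interp f : measurable (interp f).
Proof.
elim: f => [i|f IH|f IHf g IHg] /=; first exact: measurable_ratball.
  exact: measurableC.
exact: measurableU.
Qed.

Definition differ (A B : set Y) : set Y := [set y | ~ (A y <-> B y)].

Lemma differE (A B : set Y) : differ A B = (A `\` B) `|` (B `\` A).
Proof.
apply/seteqP; split=> y; rewrite /differ /setD /=; last by tauto.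
by have := EM (A y); have := EM (B y); tauto.
Qed.

Lemma measurable_differ A B : measurable A -> measurable B -> measurable (differ A B).
Proof. by move=> mA mB; rewrite differE; apply: measurableU; exact: measurableD. Qed.

(** These sets form a sigma-algebra; density follows once it is seen to contain the open sets. *)
Let approx (A : set Y) := measurable A /\
  forall e : R, 0 < e -> exists f, pr nu (differ A (interp f)) < e.

Let approxC A : approx A -> approx (~` A).
Proof.
move=> [mA hA]; split; first exact: measurableC.
move=> e /hA[f fe]; exists (Neg f); apply: le_lt_trans fe; apply: le_pr.
- by apply: measurable_differ; [exact: measurableC | exact: measurable_interp].
- by apply: measurable_differ => //; exact: measurable_interp.
by move=> y; rewrite /differ /=; tauto.
Qed.

Let approxU A B : approx A -> approx B -> approx (A `|` B).
Proof.
move=> [mA hA] [mB hB]; split; first exact: measurableU.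
move=> e e0; have e2 : 0 < e / 2 by rewrite divr_gt0.
have [[f fe] [g ge]] := (hA _ e2, hB _ e2); exists (Or f g).
have mf := measurable_interp f; have mg := measurable_interp g.
apply: (@le_lt_trans _ _ (pr nu (differ A (interp f)) + pr nu (differ B (interp g)))); last by lra.
apply: prUU; try by apply: measurable_differ => //; exact: measurableU.
by move=> y; rewrite /differ /=; have := EM (A y <-> interp f y);
  have := EM (B y <-> interp g y); tauto.
Qed.

Let approx0 : approx set0.
Proof.
(* The negation of a tautology denotes the empty set. *)
split=> // e e0; exists (Neg (Or (Atom (0%N, 0%N)) (Neg (Atom (0%N, 0%N))))).
rewrite (_ : differ _ _ = set0); first by rewrite /pr measure0.
by apply/seteqP; split=> // y; rewrite /differ /=; have := EM (ratball dist u (0%N, 0%N) y); tauto.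
Qed.

(** A finite partial union misses less than [e / 2], and a formula approximates it within the other
    half. *)
Let approx_bigcup (A : nat -> set Y) : (forall n, approx (A n)) -> approx (\bigcup_n A n).
Proof.
move=> hA; pose B n := \big[setU/set0]_(i < n) A i.
have hB n : approx (B n) by rewrite /B; elim/big_ind : _ => // i _; exact: hA.
have mU : measurable (\bigcup_n A n) by apply: bigcupT_measurable => n; case: (hA n).
split=> // e e0; have e2 : 0 < e / 2 by rewrite divr_gt0.
have [|||n nP] := @pr_cap0 _ _ _ nu (fun n => \bigcup_n A n `\` B n) (e / 2) _ _ _ e2.
- by move=> n; apply: measurableD => //; case: (hB n).
- by move=> n y [Uy nB]; split=> // Bn; apply: nB; rewrite /B big_ord_recr; left.
- apply: aeW => y; have [[k _ Ak]|nU] := pselect ((\bigcup_n A n) y); last by exists 0%N => -[].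
  by exists k.+1 => -[_]; apply; rewrite /B big_ord_recr; right.
have [mB /(_ _ e2)[f fe]] := hB n; exists f.
have mf := measurable_interp f.
apply: (@le_lt_trans _ _ (pr nu (\bigcup_n A n `\` B n) + pr nu (differ (B n) (interp f)))); last by lra.
apply: prUU; try exact: measurable_differ; first exact: measurableD.
have BU y : B n y -> (\bigcup_n A n) y by rewrite /B -bigcup_mkord => -[i _ Ai]; exists i.
move=> y; rewrite /differ /setD /=; have := BU y; have := EM (B n y); have := EM (interp f y).
by have := EM ((\bigcup_n A n) y); tauto.
Qed.

Lemma interp_dense (A : set Y) (e : R) : measurable A -> 0 < e ->
  exists f, pr nu (differ A (interp f)) < e.
Proof.
rewrite Hborel => mA e0; suff [_] : approx A by apply.
move: A mA; apply: smallest_sub.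
  split=> //; first by move=> A /approxC; rewrite setTD.
move=> A oA.
have -> : A = \bigcup_n (if unpickle n is Some i then
    if `[< ratball dist u i `<=` A >] then ratball dist u i else set0 else set0).
  apply/seteqP; split=> x.
    move=> /(ratball_nbhs Hmet udense oA)[i ix iA]; exists (pickle i) => //.
    by rewrite pickleK; case: asboolP.
  by move=> [n _]; case: (unpickle n) => // i; case: asboolP => // h /h.
apply: approx_bigcup => n; case: (unpickle n) => // i; case: asboolP => // _.
split; first exact: measurable_ratball.
move=> e' e'0; exists (Atom i); rewrite (_ : differ _ _ = set0) ?/pr ?measure0//.
by apply/seteqP; split=> // y; rewrite /differ /=; tauto.
Qed.

End DenseAlgebra.

(** * Countability of the essential centralizer *)

Section Countability.
Context (R : realType) dX (X : measurableType dX).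
Variables (mu : probability X R) (T : R -> X -> X).
Hypothesis flowT : mp_flow mu T.

Lemma ess_equiv_class S1 S2 : ess_equiv mu T S1 S2 -> ec_class mu T S1 = ec_class mu T S2.
Proof.
have mpT t : measure_preserving mu (T t) by case: flowT.
have trans A B C : ess_equiv mu T A B -> ess_equiv mu T B C -> ess_equiv mu T A C.
  move=> [t At] [s Bs]; exists (s + t).
  have h := ae_preim (mpT t).1 (mpT t).2 Bs.
  by apply: filterS2 At h => x -> ->; rewrite (flowD flowT).
have symm A B : ess_equiv mu T A B -> ess_equiv mu T B A.
  move=> [t At]; exists (- t); have h := ae_preim (mpT (- t)).1 (mpT (- t)).2 At.
  by apply: filterS h => x ->; rewrite (flowKN flowT).
move=> h; apply/seteqP; split=> S' [CS' e]; split=> //; first exact: trans h.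
exact: trans (symm _ _ h).
Qed.

Context dY (Y : measurableType dY).
Variables (dist : Y -> Y -> R) (nu : probability Y R) (S : R -> Y -> Y).
Hypothesis freeT : flow_free mu T.
Hypothesis Hmet : is_metric dist.
Hypothesis Hsc : dsigma_compact dist.
Hypothesis Hborel : @measurable dY Y = dborel dist.
Hypothesis flowS : mp_flow nu S.
Hypothesis ergS : flow_ergodic nu S.
Hypothesis ratner : metric_ratner dist nu S.
Hypothesis iso : flow_isomorphic mu T nu S.

(** An automorphism is coded by formulas approximating the preimages of the sets [C i] within
    [eta / 2]. Codes that agree at the first [n] indices put two automorphisms within [eta] on each
    of these sets, so their classes coincide; finite sequences of formulas are countable. *)
Lemma EC_countable_of_model : EC_countable mu T.
Proof.
have [phi [psi [[mphi mpsi phiP psiP] [phiK psiK phiT]]]] := iso.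
have [y0 _] := probability_inhabited nu.
have [u uP] := sigma_compact_separable Hmet Hsc y0.
have [n [C mC [eta e0 core]]] := close_ess_equiv_sets flowT freeT Hmet Hsc Hborel flowS
  ergS ratner mphi mpsi phiP psiP phiK psiK phiT.
have e2 : 0 < eta / 2 by rewrite divr_gt0.
pose near (S1 : X -> X) (c : nat -> setform) := forall i,
  pr mu [set x | ~ (C i (phi (S1 x)) <-> interp dist u (c i) (phi x))] < eta / 2.
have mI f : measurable (interp dist u f) by exact: measurable_interp.
have mCS S1 i : centralizer mu T S1 -> measurable [set x | C i (phi (S1 x))].
  move=> CS1; exact: (measurable_preimT (measurableT_comp mphi CS1.1.1.1) (mC i)).
have mN S1 i f : centralizer mu T S1 ->
    measurable [set x | ~ (C i (phi (S1 x)) <-> interp dist u f (phi x))].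
  by move=> CS1; apply: (measurable_differ (mCS _ _ CS1)); exact: measurable_preimT.
have nearE S1 : centralizer mu T S1 -> exists c, near S1 c.
  move=> CS1; suff h i : exists f,
      pr mu [set x | ~ (C i (phi (S1 x)) <-> interp dist u f (phi x))] < eta / 2.
    by have /choice[c cP] := h; exists c.
  (* The dense algebra lives on the model, so the set is carried there by [psi]. *)
  pose A := psi @^-1` [set x | C i (phi (S1 x))].
  have mA : measurable A by apply: measurable_preimT => //; exact: mCS.
  have [f fe] := interp_dense nu Hmet Hborel uP mA e2; exists f.
  have mD := measurable_differ mA (mI f).
  apply: le_lt_trans fe; rewrite -(pr_pushforward phiP mD).
  apply: le_pr_ae; [exact: mN|exact: measurable_preimT|].
  by apply: filterS phiK => x e; rewrite /differ /A /= e.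
have close S1 S2 c1 c2 : centralizer mu T S1 -> centralizer mu T S2 ->
    near S1 c1 -> near S2 c2 -> (forall i, (i < n)%N -> c1 i = c2 i) ->
    ess_equiv mu T S2 S1.
  move=> CS1 CS2 n1 n2 c12; apply: core => // i ni.
  have := n1 i; have := n2 i; rewrite -c12// => h2 h1.
  apply: (@le_lt_trans _ _ (pr mu [set x | ~ (C i (phi (S1 x)) <-> interp dist u (c1 i) (phi x))]
    + pr mu [set x | ~ (C i (phi (S2 x)) <-> interp dist u (c1 i) (phi x))])); last by lra.
  apply: prUU; [|exact: mN|exact: mN|].
    by apply: (measurable_differ (mCS _ _ CS1)); exact: mCS.
  by move=> x /=; have := EM (C i (phi (S1 x)) <-> interp dist u (c1 i) (phi x));
    have := EM (C i (phi (S2 x)) <-> interp dist u (c1 i) (phi x)); tauto.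
pose E := [set ec_class mu T S1 | S1 in centralizer mu T].
(* One representative and one code are chosen for each class; off [E] the value is arbitrary. *)
have /choice[r rP] : forall K : set (X -> X), exists Sc : (X -> X) * (nat -> setform),
    E K -> [/\ centralizer mu T Sc.1, ec_class mu T Sc.1 = K & near Sc.1 Sc.2].
  move=> K; have [[S1 CS1 <-]|nE] := pselect (E K).
    by have [c cP] := nearE _ CS1; exists (S1, c).
  by exists (id, fun=> Atom (0%N, 0%N)).
apply/pcard_injP; exists (fun K => pickle (mkseq (fun i => setform_code ((r K).2 i)) n)).
move=> K1 K2 /set_mem/rP[C1 E1 n1] /set_mem/rP[C2 E2 n2] /(pcan_inj pickleK) h.
rewrite -E1 -E2; apply/esym/ess_equiv_class; apply: close C1 C2 n1 n2 _ => i ni.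
apply: setform_code_inj.
by have := congr1 (fun s => nth 0%N s i) h; rewrite !nth_mkseq.
Qed.

End Countability.

Theorem theorem1p1 (R : realType) (d : measure_display) (X : measurableType d)
  (mu : probability X R) (T : R -> X -> X) :
  standard_borel (R:=R) (X:=X) ->
  mp_flow mu T -> flow_free mu T -> flow_ergodic mu T ->
  has_ratner_property mu T ->
  EC_discrete mu T /\ EC_countable mu T.
Proof.
move=> _ flowT freeT _ [dY [Y [dist [nu [S [[Hmet Hsc Hborel] [flowS ergS iso ratner]]]]]]].
split; last exact: (EC_countable_of_model flowT freeT Hmet Hsc Hborel flowS ergS ratner iso).
have [phi [psi [[mphi mpsi phiP psiP] [phiK psiK phiT]]]] := iso.
exact: (EC_discrete_of_model flowT freeT Hmet Hsc Hborel flowS ergS ratner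
  mphi mpsi phiP psiP phiK psiK phiT).
Qed.
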